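(* Let $M$ be a finitely generated $\mathbb{Z}^r$-graded $S$-module, let $\mathbf{v}\in\mathbb{Z}^r$ be a positive coarsening vector, and let $\mathbf{F}_\bullet:\ 0\to F_\ell\to\cdots\to F_1\to F_0\to M\to 0$ be a minimal free $\mathbb{Z}^r$-graded resolution of $M$. Assume that the Hilbert series of $M$ is supported on $\bigcup_{j=1}^{k}(\mathbf{b}_j+Q)$, where $\mathbf{b}_1,\ldots,\mathbf{b}_k\in\mathbb{Z}^r$ (that is, $M_{\mathbf{a}}\neq 0$ implies $\mathbf{a}\in\bigcup_j(\mathbf{b}_j+Q)$). Then for every $i\ge 0$ the minimal generators of $F_i$ have multidegrees contained in the finite set $$\mathcal{D}_{i,\mathbf{v}}(M):=\Big\{\mathbf{a}\in\bigcup_{j=1}^k(\mathbf{b}_j+Q)\ \Big|\ \mathbf{a}\cdot\mathbf{v}\le \operatorname{reg-num}_{\mathbf{v}}(M)+i s_{\mathbf{v}}+c_{\mathbf{v}}-1\Big\}.$$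
   Context: Let $K$ be a field and $S=K[x_1,\ldots,x_n]$, with a $\mathbb{Z}^r$-grading given by $\deg(x_i)=\mathbf{a}_i\in\mathbb{Z}^r$. Let $Q\subseteq\mathbb{Z}^r$ be the subsemigroup (containing $0$) generated by $\mathbf{a}_1,\ldots,\mathbf{a}_n$. $S$ is assumed positively multigraded: $\deg(x_i)\ne 0$ for all $i$ and $Q$ has no nonzero invertible elements. A vector $\mathbf{v}\in\mathbb{Z}^r$ is a positive coarsening vector if $\deg_{\mathbf{v}}(x_i):=\mathbf{a}_i\cdot\mathbf{v}>0$ for all $i$. For a $\mathbb{Z}^r$-graded module $M$, $M^{[\mathbf{v}]}$ denotes $M$ with the $\mathbb{Z}$-grading $(M^{[\mathbf{v}]})_m=\bigoplus_{\mathbf{a}\cdot\mathbf{v}=m}M_{\mathbf{a}}$; it is a graded module over $S^{[\mathbf{v}]}$. Put $\mathfrak{m}=\langle x_1,\ldots,x_n\rangle$, $c_{\mathbf{v}}=\operatorname{lcm}(\deg_{\mathbf{v}}(x_1),\ldots,\deg_{\mathbf{v}}(x_n))$ and $s_{\mathbf{v}}=\max\{nc_{\mathbf{v}}-\sum_{i=1}^n\deg_{\mathbf{v}}(x_i),\ c_{\mathbf{v}}\}$. Define $$\operatorname{reg}_{\mathbf{v}}(M)=\{p\in\mathbb{Z}\mid H^i_{\mathfrak{m}}(M^{[\mathbf{v}]})_q=0\ \text{for all } i\ge 0 \text{ and all } q\in p+(1-i)c_{\mathbf{v}}+\mathbb{N}c_{\mathbf{v}}\},$$ where $\mathbb{N}$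 contains $0$, and $\operatorname{reg-num}_{\mathbf{v}}(M)=\inf\{p\in\operatorname{reg}_{\mathbf{v}}(M)\mid q\in\operatorname{reg}_{\mathbf{v}}(M)\text{ for all } q\ge p\}$ (which is $-\infty$ if $M=0$). *)

(* Defs.v *)
From HB Require Import structures.
From mathcomp Require Import all_boot all_order all_algebra zify.
From mathcomp Require Import mpoly.
From mathcomp Require Import boolp classical_sets cardinality constructive_ereal.

Set Implicit Arguments.
Unset Strict Implicit.
Unset Printing Implicit Defensive.

Import Order.TTheory GRing.Theory Num.Theory.

Local Open Scope classical_set_scope.
Local Open Scope ring_scope.
Local Open Scope quotient_scope.

(* The localization M_f of a module at one element: a pair (m, k) represents
   the fraction m / f^k. *)
Section Localization.
Variables (R : comNzRingType) (M : lmodType R) (f : R).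

Definition loc_eqv (x y : M * nat) : bool :=
  `[< exists N : nat, f ^+ (N + y.2) *: x.1 = f ^+ (N + x.2) *: y.1 >].

Fact loc_eqv_refl : ssrbool.reflexive loc_eqv.
Proof. by move=> x; apply/asboolP; exists 0%N. Qed.

Fact loc_eqv_sym : ssrbool.symmetric loc_eqv.
Proof. by move=> x y; apply/asboolP/asboolP => -[N e]; exists N. Qed.

Fact loc_eqv_trans : ssrbool.transitive loc_eqv.
Proof.
move=> [y j] [x i] [z k] /asboolP[N /= eN] /asboolP[P /= eP].
apply/asboolP; exists (N + P + j)%N => /=.
have -> : (N + P + j + k = (P + k) + (N + j))%N by lia.
rewrite exprD -scalerA eN scalerA -exprD.
have -> : (P + k + (N + i) = (N + i) + (P + k))%N by lia.
have -> : (N + P + j + i = (N + i) + (P + j))%N by lia.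
by rewrite exprD -scalerA eP scalerA -exprD.
Qed.

Canonical loc_eqv_equiv := EquivRel loc_eqv loc_eqv_refl loc_eqv_sym
  loc_eqv_trans.

Definition localization := {eq_quot loc_eqv}.

HB.instance Definition _ := EqQuotient.on localization.
HB.instance Definition _ := Choice.on localization.

Definition frac (m : M) (k : nat) : localization := \pi_localization (m, k).

Lemma fracP (m m' : M) (k k' : nat) :
  frac m k = frac m' k' <->
  exists N : nat, f ^+ (N + k') *: m = f ^+ (N + k) *: m'.
Proof.
rewrite /frac; split=> [/eqmodP/asboolP //|h].
by apply/eqmodP/asboolP.
Qed.

Lemma fracE (y : localization) : y = frac (repr y).1 (repr y).2.
Proof. by rewrite /frac -surjective_pairing reprK. Qed.

Definition loc_zero : localization := frac 0 0.
Definition loc_opp (y : localization) : localization :=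
  frac (- (repr y).1) (repr y).2.
Definition loc_add (y z : localization) : localization :=
  frac (f ^+ (repr z).2 *: (repr y).1 + f ^+ (repr y).2 *: (repr z).1)
       ((repr y).2 + (repr z).2).

Lemma loc_oppE m k : loc_opp (frac m k) = frac (- m) k.
Proof.
apply/fracP; have /fracP[N e] := esym (fracE (frac m k)).
by exists N; rewrite !scalerN e.
Qed.

Lemma loc_addE m k m' k' :
  loc_add (frac m k) (frac m' k') =
  frac (f ^+ k' *: m + f ^+ k *: m') (k + k').
Proof.
apply/fracP.
have /fracP[N e] := esym (fracE (frac m k)).
have /fracP[N' e'] := esym (fracE (frac m' k')).
move: (repr _).1 (repr _).2 e (repr _).1 (repr _).2 e' => p i e p' i' e'.
exists (N + N')%N; rewrite !scalerDr !scalerA -!exprD; congr (_ + _).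
  have -> : (N + N' + (k + k') + i' = (N' + k' + i') + (N + k))%N by lia.
  rewrite exprD -scalerA e scalerA -exprD.
  by congr (f ^+ _ *: _); lia.
have -> : (N + N' + (k + k') + i = (N + k + i) + (N' + k'))%N by lia.
rewrite exprD -scalerA e' scalerA -exprD.
by congr (f ^+ _ *: _); lia.
Qed.

Fact loc_addA : associative loc_add.
Proof.
move=> x y z; rewrite (fracE x) (fracE y) (fracE z) !loc_addE.
rewrite !scalerDr !scalerA -!exprD addrA addnA.
by rewrite (addnC (repr z).2) (addnC (repr z).2).
Qed.

Fact loc_addC : commutative loc_add.
Proof.
by move=> x y; rewrite (fracE x) (fracE y) !loc_addE addrC [in RHS]addnC.
Qed.

Fact loc_add0 : left_id loc_zero loc_add.
Proof. by move=> x; rewrite (fracE x) loc_addE scaler0 add0r scale1r. Qed.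

Fact loc_addN : left_inverse loc_zero loc_opp loc_add.
Proof.
move=> x; rewrite (fracE x) loc_oppE loc_addE scalerN addNr.
by apply/fracP; exists 0%N; rewrite !scaler0.
Qed.

HB.instance Definition _ := GRing.isZmodule.Build localization
  loc_addA loc_addC loc_add0 loc_addN.

End Localization.

(* For g = f * h, the canonical map M_f -> M_g, m / f^k |-> (h^k m) / g^k. *)
Definition loc_map (R : comNzRingType) (M : lmodType R) (f g h : R)
    (y : localization M f) : localization M g :=
  frac g (h ^+ (repr y).2 *: (repr y).1) (repr y).2.

Lemma loc_mapE (R : comNzRingType) (M : lmodType R) (f g h : R) (m : M)
    (k : nat) :
  g = f * h -> loc_map g h (frac f m k) = frac g (h ^+ k *: m) k.
Proof.
move=> gE; apply/fracP.
have /fracP[N e] := esym (fracE (frac f m k)).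
exists N; rewrite gE !exprMn !scalerA.
move: (repr _).1 (repr _).2 e => p i e.
rewrite -!mulrA -!exprD !(mulrC (f ^+ _)) -!scalerA e !scalerA.
by congr ((h ^+ _ * _) *: _); lia.
Qed.

Section Graded.
Variables (K : fieldType) (n : nat).
Local Notation S := {mpoly K[n]}.

Section Group.
(* G is the grading group and dg gives the degrees of the variables. *)
Variables (G : zmodType) (dg : 'I_n -> G).

Definition poly_piece (a : G) : set S :=
  [set p | forall u : 'X_{1..n}, u \in msupp p -> \sum_(i < n) dg i *+ u i = a].

Record is_graded_module (M : lmodType S) (Mg : G -> set M) : Prop := {
  piece0 : forall a, Mg a 0;
  pieceB : forall a x y, Mg a x -> Mg a y -> Mg a (x - y);
  pieceZ : forall a b p x, poly_piece a p -> Mg b x -> Mg (a + b) (p *: x);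
  piece_span : forall x, exists (s : seq G) (c : G -> M),
    (forall a, Mg a (c a)) /\ x = \sum_(a <- s) c a;
  piece_free : forall (s : seq G) (c : G -> M), uniq s ->
    (forall a, Mg a (c a)) -> \sum_(a <- s) c a = 0 ->
    forall a, a \in s -> c a = 0 }.

Section Cech.
Variables (M : lmodType S) (Mg : G -> set M).

Definition xprod (s : {set 'I_n}) : S := \prod_(j in s) 'X_j.

Definition loc_piece (s : {set 'I_n}) (q : G) :
    set (localization M (xprod s)) :=
  [set y | exists (m : M) (k : nat),
     y = frac (xprod s) m k /\ Mg (q + (\sum_(j in s) dg j) *+ k) m].

(* The Cech complex of M on x_1, ..., x_n: all cochain groups
   C^i = \bigoplus_(#|s| = i) M_{x_s} are collected in a single type, in which
   cech_cochain i q is the degree q part of C^i. *)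
Definition cech_family := forall s : {set 'I_n}, localization M (xprod s).

Definition cech_cochain (i : nat) (q : G) (c : cech_family) : Prop :=
  forall s : {set 'I_n}, if #|s| == i then loc_piece q (c s) else c s = 0.

Definition cech_diff (c : cech_family) : cech_family := fun t =>
  \sum_(j in t) loc_map (xprod t) 'X_j (c (t :\ j)%SET)
    *~ ((-1) ^+ #|[set l in t | (l < j)%N]%SET|).

(* H^i_m(M)_q = 0, with H^i_m(M) the i-th cohomology of the Cech complex. *)
Definition local_cohomology_vanishes (i : nat) (q : G) : Prop :=
  forall c : cech_family, cech_cochain i q c ->
    (forall t, cech_diff c t = 0) ->
    if i is i'.+1 then
      exists2 b, cech_cochain i' q b & forall s, cech_diff b s = c s
    else forall s, c s = 0.

End Cech.

Definition homogeneous_generators (M : lmodType S) (Mg : G -> set M) (k : nat)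
    (g : 'I_k -> M) (d : 'I_k -> G) : Prop :=
  (forall j, Mg (d j) (g j)) /\
  (forall x, exists c : 'I_k -> S, x = \sum_(j < k) c j *: g j).

Definition minimal_generators (M : lmodType S) (Mg : G -> set M) (k : nat)
    (g : 'I_k -> M) (d : 'I_k -> G) : Prop :=
  homogeneous_generators Mg g d /\
  forall (l : 'I_k) (c : 'I_k -> S), g l <> \sum_(j < k | j != l) c j *: g j.

Definition graded_free (M : lmodType S) (Mg : G -> set M) : Prop :=
  exists (k : nat) (e : 'I_k -> M) (d : 'I_k -> G),
    homogeneous_generators Mg e d /\
    forall c : 'I_k -> S, \sum_(j < k) c j *: e j = 0 -> forall j, c j = 0.

Definition maximal_ideal_submodule (M : lmodType S) : set M :=
  [set x | exists y : 'I_n -> M, x = \sum_(i < n) ('X_i : S) *: y i].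

(* 0 -> F_l -> ... -> F_1 -> F_0 -> M -> 0, with F_i = 0 for i > l. *)
Record is_minimal_free_resolution (M : lmodType S) (Mg : G -> set M)
    (F : nat -> lmodType S) (Fg : forall i, G -> set (F i))
    (d : forall i, {linear F i.+1 -> F i}) (eps : {linear F 0%N -> M})
    (l : nat) : Prop := {
  res_graded : forall i, is_graded_module (Fg i);
  res_free : forall i, graded_free (Fg i);
  res_length : forall i, (l < i)%N -> forall x : F i, x = 0;
  res_homog : forall i a x, Fg i.+1 a x -> Fg i a (d i x);
  res_eps_homog : forall a x, Fg 0%N a x -> Mg a (eps x);
  res_eps_surj : forall m, exists x, eps x = m;
  res_exact0 : forall x, eps x = 0 <-> exists y, d 0%N y = x;
  res_exactS : forall i x, d i x = 0 <-> exists y, d i.+1 y = x;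
  res_minimal : forall i x, maximal_ideal_submodule (d i x) }.

End Group.

Definition finitely_generated (M : lmodType S) : Prop :=
  exists (k : nat) (g : 'I_k -> M),
    forall x, exists c : 'I_k -> S, x = \sum_(j < k) c j *: g j.

Section Multigraded.
Variables (r : nat) (dg : 'I_n -> 'rV[int]_r).

Definition dotv (a v : 'rV[int]_r) : int := \sum_(t < r) a 0 t * v 0 t.

Definition degree_semigroup : set 'rV[int]_r :=
  [set u | exists k : 'I_n -> nat, u = \sum_(i < n) dg i *+ k i].

Definition positively_multigraded : Prop :=
  (forall i, dg i != 0) /\
  forall u, degree_semigroup u -> degree_semigroup (- u) -> u = 0.

(* \bigcup_j (b_j + Q) *)
Definition translates (k : nat) (b : 'I_k -> 'rV[int]_r) : set 'rV[int]_r :=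
  [set a | exists j, exists2 u, degree_semigroup u & a = b j + u].

Section Coarsening.
Variable v : 'rV[int]_r.

Definition degv (i : 'I_n) : int := dotv (dg i) v.

Definition positive_coarsening : Prop := forall i, 0 < degv i.

Definition coarsen (M : lmodType S) (Mg : 'rV[int]_r -> set M) : int -> set M :=
  fun m => [set x | exists (s : seq 'rV[int]_r) (c : 'rV[int]_r -> M),
    [/\ forall a, a \in s -> dotv a v = m, forall a, Mg a (c a)
      & x = \sum_(a <- s) c a]].

Definition cv : int := (\big[lcmn/1%N]_(i < n) `|degv i|%N)%:Z.

Definition sv : int := Num.max (n%:Z * cv - \sum_(i < n) degv i) cv.

Definition regv (M : lmodType S) (Mg : 'rV[int]_r -> set M) : set int :=
  [set p | forall i k : nat,
     local_cohomology_vanishes degv (coarsen Mg) i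
       (p + (1 - i%:Z) * cv + k%:Z * cv)].

(* The infimum is taken in the integers extended by -oo and +oo. *)
Definition reg_num (M : lmodType S) (Mg : 'rV[int]_r -> set M) : \bar int :=
  infimum +oo%E
    [set p%:E%E | p in [set p | regv Mg p /\ forall q, p <= q -> regv Mg q]].

Definition degree_bound_set (M : lmodType S) (Mg : 'rV[int]_r -> set M)
    (k : nat) (b : 'I_k -> 'rV[int]_r) (i : nat) : set 'rV[int]_r :=
  [set a | translates b a /\
     ((dotv a v)%:E <= reg_num Mg + (i%:Z * sv + cv - 1)%:E)%E].

End Coarsening.
End Multigraded.
End Graded.

(* Main.v *)
Require Import Defs.
From mathcomp Require Import all_boot all_order all_algebra mpoly.
From mathcomp Require Import boolp classical_sets cardinality constructive_ereal.
From HB Require Import structures.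
From mathcomp Require Import zify ring.
(* Imported last: finite sets and fractions of localizations take precedence
   over the notions of the same name for sets in Prop and fraction fields. *)
From mathcomp Require Import ssrbool eqtype fintype finset.
Require Import Defs.

(** Write [s] for [sv], [C] for [cv], and coarsen the grading by [v], so that the
    variables have positive integer degrees dividing [C].  Say that [M] is
    regular from [p] if H^i(M) vanishes in all degrees at least [p + (1 - i) C],
    for every [i]; this amounts to [p] and all larger integers lying in the
    regularity set ([regular_fromE]).

    The key fact is Mumford's lemma ([regular_generation]): if [M] is regular
    from [p], then each homogeneous element of degree at least [p + C] lies in
    the ideal generated by the powers [y_l] of the variables that have degree
    [C], times [M].  For [m] of such a degree consider the double complex with
    Cech and Koszul (for [y_1, ..., y_n]) differentials.  The fractions
    [m / \prod_(l in J) y_l], placed at the positions [(J, J)], form a family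
    on which the two differentials agree ([diagonal_cocycle]).  The vanishing of
    H^j(M) in degree [q - j C] allows to correct this family, from [j = n] down
    to [j = 0] ([double_complex_descent]); what remains at the end is an
    expression of [m] as a combination of the [y_l].

    Applied to [M] this bounds the generators of [F 0] by [p + C - 1].  The
    local cohomology of [S] is concentrated in cohomological degree [n] and in
    degrees at most minus the sum of the degrees of the variables
    ([polynomial_ring_vanishes], by contracting the Cech complex monomial by
    monomial).  The exact sequence of [0 -> N -> F 0 -> M -> 0] then shows that
    the first syzygy module [N] is regular from [p + s] ([syzygy_regular]).
    Since [N] is resolved by the tail of the resolution, induction shows that
    homogeneous elements of [F i] of degree at least [p + i s + C] lie in the
    maximal ideal times [F i] ([resolution_generation]), and a minimal
    generator does not ([minimal_generator_notin_maximal_ideal]).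

    The same exact sequences, read in the other direction along the finite
    resolution, show that [M] is regular from some [p] ([regular_eventually]), so
    the regularity number is not [+oo] and the degree set is finite.  Finally,
    minimality makes the differential nonzero on a basis, so the degrees that
    occur in [F i] propagate from the support of [M] ([resolution_support]). *)

Set Implicit Arguments.
Unset Strict Implicit.
Unset Printing Implicit Defensive.

Import Order.TTheory GRing.Theory Num.Theory.

Local Open Scope ring_scope.

(** * Homogeneous components *)

Section WeightedDegree.
Variables (K : fieldType) (n : nat) (G : zmodType) (dg : 'I_n -> G).
Local Notation S := {mpoly K[n]}.

Definition wdegree (u : 'X_{1..n}) : G := \sum_(i < n) dg i *+ u i.

Lemma wdegreeD (u w : 'X_{1..n}) : wdegree (u + w)%MM = wdegree u + wdegree w.
Proof.
rewrite /wdegree -big_split; apply: eq_bigr => i _.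
by rewrite mnmDE mulrnDr.
Qed.

Lemma wdegree0 : wdegree 0%MM = 0.
Proof. by rewrite /wdegree big1 // => i _; rewrite mnm0E. Qed.

Lemma poly_pieceX (u : 'X_{1..n}) : @poly_piece K n G dg (wdegree u) 'X_[u].
Proof. by move=> w; rewrite msuppX inE => /eqP ->. Qed.

Lemma poly_pieceZ a (c : K) (p : S) :
  poly_piece dg a p -> poly_piece dg a (c *: p).
Proof. by move=> h u /msuppZ_le /h. Qed.

Lemma poly_piece0 a : poly_piece dg a (0 : S).
Proof. by move=> u; rewrite msupp0. Qed.

Lemma poly_pieceD a (p q : S) :
  poly_piece dg a p -> poly_piece dg a q -> poly_piece dg a (p + q).
Proof. by move=> hp hq u /msuppD_le; rewrite mem_cat => /orP[/hp|/hq]. Qed.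

Lemma poly_piece_coef a (p : S) :
  poly_piece dg a p <-> forall u, p@_u != 0 -> wdegree u = a.
Proof.
by split=> h u; [rewrite -mcoeff_msupp|rewrite mcoeff_msupp]; apply: h.
Qed.

Lemma poly_pieceM a b (p q : S) :
  poly_piece dg a p -> poly_piece dg b q -> poly_piece dg (a + b) (p * q).
Proof.
move=> hp hq w /msuppM_le /allpairsP[[u t] /= [/hp <- /hq <- ->]].
exact: wdegreeD.
Qed.

Definition poly_restrict (P : pred 'X_{1..n}) (p : S) : S :=
  \sum_(u <- msupp p | P u) p@_u *: 'X_[u].

Lemma mcoeff_restrict P p u : (poly_restrict P p)@_u = if P u then p@_u else 0.
Proof.
rewrite raddf_sum /=; case: ifPn => hu; last first.
  rewrite big1 // => w hw; rewrite mcoeffZ mcoeffX.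
  by case: eqP => [e|_]; [rewrite -e hw in hu|rewrite mulr0].
case: (boolP (u \in msupp p)) => hs; last first.
  rewrite big1 => [|w _]; first by rewrite memN_msupp_eq0.
  rewrite mcoeffZ mcoeffX; case: eqP => [->|_]; last by rewrite mulr0.
  by rewrite memN_msupp_eq0 // mul0r.
rewrite -big_filter (bigD1_seq u) /=; last 2 first.
- by rewrite mem_filter hu.
- by rewrite filter_uniq // msupp_uniq.
rewrite mcoeffZ mcoeffX eqxx mulr1 big1 ?addr0 // => w /negPf hw.
by rewrite mcoeffZ mcoeffX hw mulr0.
Qed.

Lemma poly_restrict_zmod P : zmod_morphism (poly_restrict P).
Proof.
move=> p q; apply/mpolyP => u; rewrite mcoeffB !mcoeff_restrict mcoeffB.
by case: ifP; rewrite ?subrr.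
Qed.

HB.instance Definition _ P :=
  GRing.isZmodMorphism.Build S S (poly_restrict P) (poly_restrict_zmod P).

Definition poly_component (a : G) : S -> S :=
  poly_restrict (fun u => wdegree u == a).

Lemma poly_componentP a p : poly_piece dg a (poly_component a p).
Proof.
apply/poly_piece_coef => u; rewrite mcoeff_restrict.
by case: ifP => [/eqP //|_]; rewrite eqxx.
Qed.

End WeightedDegree.

Lemma sum_widen (I : eqType) (V : nmodType) (r t : seq I) (g : I -> V) :
  uniq r -> uniq t -> {subset r <= t} -> (forall b, b \notin r -> g b = 0) ->
  \sum_(b <- r) g b = \sum_(b <- t) g b.
Proof.
move=> ur ut sub g0; rewrite [RHS](bigID (mem r)) /= [X in _ + X]big1 ?addr0 //.
rewrite -[RHS]big_filter; apply: perm_big; apply: uniq_perm => //.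
  by rewrite filter_uniq.
by move=> b; rewrite mem_filter; case: (boolP (b \in r)) => // /sub ->.
Qed.

Section Components.
Variables (K : fieldType) (n : nat) (G : zmodType) (dg : 'I_n -> G).
Local Notation S := {mpoly K[n]}.
Variables (M : lmodType S) (Mg : G -> set M).
Hypothesis hM : is_graded_module dg Mg.

Lemma pieceN a x : Mg a x -> Mg a (- x).
Proof.
by move=> hx; rewrite -[- x]add0r; apply: (pieceB hM) => //; apply: (piece0 hM).
Qed.

Lemma pieceD a x y : Mg a x -> Mg a y -> Mg a (x + y).
Proof.
by move=> hx hy; rewrite -[y]opprK; apply: (pieceB hM) => //; apply: pieceN.
Qed.

Lemma pieceMn a x m : Mg a x -> Mg a (x *+ m).
Proof.
by move=> h; elim: m => [|m ih]; rewrite ?mulrS; [apply: (piece0 hM)|apply: pieceD].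
Qed.

(** A family indexed by all degrees, so that two decompositions of [x] can be
    compared degree by degree. *)
Definition decomposes (x : M) (c : G -> M) : Prop :=
  (forall a, Mg a (c a)) /\
  exists s : seq G, [/\ uniq s, forall a, a \notin s -> c a = 0
                      & x = \sum_(a <- s) c a].

Lemma decomposition_exists x : exists c, decomposes x c.
Proof.
have [s [c [hc ->]]] := piece_span hM x.
exists (fun a => c a *+ count_mem a s); split.
  by move=> a; apply: pieceMn.
exists (undup s); split; first exact: undup_uniq.
  by move=> a; rewrite mem_undup => /count_memPn ->.
rewrite -big_undup_iterop_count; apply: eq_bigr => a _.
by rewrite Monoid.iteropE iter_addr addr0.
Qed.

Lemma decomposition_uniq x c c' :
  decomposes x c -> decomposes x c' -> forall a, c a = c' a.
Proof.
move=> [hc [s [us s0 es]]] [hc' [s' [us' s0' es']]] a.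
pose t := undup (a :: s ++ s').
have e0 : \sum_(b <- t) (c b - c' b) = 0.
  rewrite sumrB -(sum_widen us _ _ s0) -?(sum_widen us' _ _ s0') -?es -?es';
    rewrite ?subrr ?undup_uniq //.
    by move=> b hb; rewrite mem_undup inE mem_cat hb !orbT.
  by move=> b hb; rewrite mem_undup inE mem_cat hb !orbT.
apply/eqP; rewrite -subr_eq0; apply/eqP.
apply: (piece_free hM (undup_uniq _) _ e0) => [b|]; first exact: (pieceB hM).
by rewrite mem_undup inE eqxx.
Qed.

Definition component (a : G) (x : M) : M :=
  projT1 (cid (decomposition_exists x)) a.

Lemma componentP x : decomposes x (component^~ x).
Proof. exact: (projT2 (cid (decomposition_exists x))). Qed.

Lemma componentE x c a : decomposes x c -> component a x = c a.
Proof. by move=> h; apply: (decomposition_uniq (componentP x) h). Qed.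

Lemma component_homog a x : Mg a (component a x).
Proof. by have [h _] := componentP x; apply: h. Qed.

Lemma component_piece a b x : Mg b x -> component a x = if a == b then x else 0.
Proof.
move=> hx; apply: (@componentE _ (fun a => if a == b then x else 0)); split.
  by move=> a'; case: eqP => [->//|_]; apply: (piece0 hM).
exists [:: b]; split=> //= [a'|]; first by rewrite inE => /negPf ->.
by rewrite big_seq1 eqxx.
Qed.

Lemma component_zmod a : zmod_morphism (component a).
Proof.
move=> x y; apply: (@componentE _ (fun a => component a x - component a y)).
have [hx [s [us s0 es]]] := componentP x.
have [hy [t [ut t0 et]]] := componentP y.
split=> [b|]; first exact: (pieceB hM).
exists (undup (s ++ t)); rewrite undup_uniq; split=> //.
  by move=> b; rewrite mem_undup mem_cat negb_or => /andP[/s0 -> /t0 ->]; rewrite subrr.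
rewrite {1}es {1}et sumrB; congr (_ - _); apply: sum_widen;
  rewrite ?undup_uniq // => b hb; by rewrite mem_undup mem_cat hb ?orbT.
Qed.

HB.instance Definition _ a :=
  GRing.isZmodMorphism.Build M M (component a) (component_zmod a).

Lemma component_eq0 x : (forall a, component a x = 0) -> x = 0.
Proof. by move=> h; have [_ [s [_ _ ->]]] := componentP x; rewrite big1. Qed.

(** Monomials move a homogeneous element to distinct degrees according to their
    weight, so each component of [p *: x] comes from a component of [p]. *)
Lemma component_scale a b (p : S) x :
  Mg b x -> component a (p *: x) = poly_component dg (a - b) p *: x.
Proof.
move=> hx; rewrite [in LHS](mpolyE p) scaler_suml raddf_sum /=.
rewrite /poly_component /poly_restrict scaler_suml big_mkcond [RHS]big_mkcond /=.
rewrite !big_seq; apply: eq_bigr => u hu.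
have hu' : poly_piece dg (wdegree dg u) (p@_u *: 'X_[u]).
  exact/poly_pieceZ/poly_pieceX.
by rewrite (component_piece _ (pieceZ hM hu' hx)) -subr_eq [a - b == _]eq_sym.
Qed.

End Components.
(** * Free modules and minimal generators *)

Lemma mcoeff0_sumX (K : fieldType) (n : nat) (f : 'I_n -> {mpoly K[n]}) :
  (\sum_(i < n) 'X_i * f i)@_0%MM = 0.
Proof.
rewrite raddf_sum big1 //= => i _; rewrite rmorphM /= mcoeffX.
have /negPf -> : U_(i)%MM != 0%MM :> 'X_{1..n}.
  by apply/eqP => /mnmP /(_ i); rewrite mnm1E eqxx mnm0E.
by rewrite mul0r.
Qed.

Section Coordinates.
Variables (K : fieldType) (n : nat) (G : zmodType) (dg : 'I_n -> G).
Local Notation S := {mpoly K[n]}.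
Variables (M : lmodType S) (Mg : G -> set M).
Variables (k : nat) (e : 'I_k -> M) (d : 'I_k -> G).
Hypothesis spanning : homogeneous_generators Mg e d.
Hypothesis independent :
  forall c : 'I_k -> S, \sum_(j < k) c j *: e j = 0 -> forall j, c j = 0.

Definition coordinate (j : 'I_k) (x : M) : S^o := projT1 (cid (spanning.2 x)) j.

Lemma coordinate_sum x : x = \sum_(j < k) (coordinate j x : S) *: e j.
Proof. exact: (projT2 (cid (spanning.2 x))). Qed.

Lemma coordinate_uniq (c : 'I_k -> S) x :
  x = \sum_(j < k) c j *: e j -> forall j, coordinate j x = c j.
Proof.
move=> ex j; apply/eqP; rewrite -subr_eq0; apply/eqP.
apply: (independent (c := fun j => coordinate j x - c j)).
under eq_bigr => i _ do rewrite scalerBl.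
by rewrite sumrB -coordinate_sum -ex subrr.
Qed.

Lemma coordinate_linear j : linear (coordinate j).
Proof.
move=> a x y.
rewrite (@coordinate_uniq (fun j => a * coordinate j x + coordinate j y)) //.
rewrite {1}[x]coordinate_sum {1}[y]coordinate_sum scaler_sumr -big_split /=.
by apply: eq_bigr => i _; rewrite scalerDl scalerA.
Qed.

HB.instance Definition _ j :=
  GRing.isLinear.Build S M S^o _ (coordinate j) (coordinate_linear j).

Definition coordinate_map j : {linear M -> S^o} := coordinate j.

Lemma coordinate_basis j i : coordinate j (e i) = (j == i)%:R.
Proof.
rewrite (@coordinate_uniq (fun j => (j == i)%:R)) // (bigD1 i) //= eqxx scale1r.
by rewrite big1 ?addr0 // => l /negPf ->; rewrite scale0r.
Qed.

(** Compare [x], expanded on the basis, with its degree [a] component. *)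
Lemma coordinate_piece (hM : is_graded_module dg Mg) a x j :
  Mg a x -> poly_piece dg (a - d j) (coordinate j x : S).
Proof.
move=> hx; have -> : coordinate j x = poly_component dg (a - d j) (coordinate j x).
  apply: (@coordinate_uniq (fun j => poly_component dg (a - d j) (coordinate j x))).
  have {1}-> : x = component hM a x by rewrite (component_piece _ _ hx) eqxx.
  rewrite {1}[x]coordinate_sum raddf_sum; apply: eq_bigr => i _.
  exact/component_scale/spanning.1.
exact: poly_componentP.
Qed.

Lemma free_module_support (hM : is_graded_module dg Mg) a x :
  Mg a x -> x <> 0 -> exists j u, a = d j + wdegree dg u.
Proof.
move=> hx x0.
have [j cj] : exists j, coordinate j x <> 0.
  apply: contrapT => h; apply: x0; rewrite [x]coordinate_sum.
  rewrite big1 // => j _; have [->|/eqP cj] := eqVneq (coordinate j x) 0.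
    by rewrite scale0r.
  by case: h; exists j.
have [u hu] : exists u, u \in msupp (coordinate j x : S).
  case E : (msupp (coordinate j x : S)) => [|u s].
    by case: cj; apply/eqP; rewrite -msupp_eq0 E.
  by exists u; rewrite inE eqxx.
exists j, u; have /(_ u hu) := coordinate_piece hM hx (j := j).
by rewrite -/(wdegree dg u) => ->; rewrite addrC subrK.
Qed.

(** An element of [m M] has all its coordinates in [m], and 1 is not in [m]. *)
Lemma basis_notin_maximal_ideal j : ~ maximal_ideal_submodule (e j).
Proof.
move=> [y ey]; have := coordinate_basis j j.
rewrite ey linear_sum eqxx /= => /(congr1 (mcoeff 0%MM)) /eqP.
under eq_bigr => i _ do rewrite linearZ.
by rewrite mcoeff0_sumX mcoeff1 eqxx eq_sym oner_eq0.
Qed.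

End Coordinates.

(** A graded form of Nakayama's lemma: when only constants have degree 0, the
    degree [d l] component of an expression of [g l] with coefficients in [m]
    does not involve [g l], contrary to minimality. *)
Lemma minimal_generator_notin_maximal_ideal (K : fieldType) (n : nat)
    (G : zmodType) (dg : 'I_n -> G) (M : lmodType {mpoly K[n]})
    (Mg : G -> set M) (k : nat) (g : 'I_k -> M) (d : 'I_k -> G) :
  (forall u : 'X_{1..n}, wdegree dg u = 0 -> u = 0%MM) ->
  is_graded_module dg Mg -> minimal_generators Mg g d ->
  forall l, ~ maximal_ideal_submodule (g l).
Proof.
move=> pos hM [[hg gen] min] l [y ey].
pose b i := projT1 (cid (gen (y i))).
have eb i : y i = \sum_(j < k) b i j *: g j by exact: (projT2 (cid (gen (y i)))).
pose c j := \sum_(i < n) 'X_i * b i j.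
have ec : g l = \sum_(j < k) c j *: g j.
  rewrite ey; under eq_bigr => i _ do rewrite eb scaler_sumr.
  rewrite exchange_big; apply: eq_bigr => j _; rewrite scaler_suml.
  by apply: eq_bigr => i _; rewrite scalerA.
have c0 : poly_component dg (d l - d l) (c l) = 0.
  apply/mpolyP => u; rewrite mcoeff_restrict mcoeff0 subrr.
  by case: eqP => // /pos ->; rewrite mcoeff0_sumX.
apply: (min l (fun j => poly_component dg (d l - d j) (c j))).
have {1}-> : g l = component hM (d l) (g l).
  by rewrite (component_piece _ _ (hg l)) eqxx.
rewrite {1}ec raddf_sum (bigD1 l) //= (component_scale _ _ _ (hg l)) c0.
rewrite scale0r add0r; apply: eq_bigr => j _.
exact/component_scale/hg.
Qed.
(** * Localization as an exact functor *)

Section Fractions.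
Variables (R : comNzRingType) (M : lmodType R) (f : R).
Implicit Types (m : M) (k : nat).

Lemma fracDD m m' k k' :
  frac f m k + frac f m' k' = frac f (f ^+ k' *: m + f ^+ k *: m') (k + k').
Proof. exact: loc_addE. Qed.

Lemma frac_scale j m k : frac f (f ^+ j *: m) (j + k) = frac f m k.
Proof. by apply/fracP; exists 0%N; rewrite scalerA -exprD !add0n addnC. Qed.

Lemma fracD m m' k : frac f (m + m') k = frac f m k + frac f m' k.
Proof. by rewrite fracDD -scalerDr frac_scale. Qed.

Lemma fracN m k : frac f (- m) k = - frac f m k.
Proof. by rewrite -[RHS]/(loc_opp _) loc_oppE. Qed.

Lemma frac0 k : frac f (0 : M) k = 0.
Proof. by apply/fracP; exists 0%N; rewrite !scaler0. Qed.

Lemma frac_sum I (r : seq I) (P : pred I) (m : I -> M) k :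
  frac f (\sum_(i <- r | P i) m i) k = \sum_(i <- r | P i) frac f (m i) k.
Proof. exact: (big_morph (fun m => frac f m k) (fun x y => fracD x y k) (frac0 k)). Qed.

Lemma fracMz m k z : frac f (m *~ z) k = frac f m k *~ z.
Proof. have frac_Mn j : frac f (m *+ j) k = frac f m k *+ j.
  by elim: j => [|j ih]; rewrite ?frac0 // !mulrS fracD ih.
by case: z => j; rewrite ?NegzE ?mulrNz ?fracN -!pmulrn frac_Mn.
 Qed.

Lemma frac_eq0 m k : frac f m k = 0 <-> exists N, f ^+ N *: m = 0.
Proof.
rewrite -(frac0 0); split=> [/fracP[N]|[N e]].
  by rewrite scaler0 addn0; exists N.
by apply/fracP; exists N; rewrite scaler0 addn0.
Qed.

Lemma frac_ind (P : localization M f -> Prop) :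
  (forall m k, P (frac f m k)) -> forall y, P y.
Proof. by move=> h y; rewrite [y]fracE. Qed.

End Fractions.

Section LocalizedMaps.
Variables (R : comNzRingType) (M N : lmodType R) (f : R).
Variable phi : {linear M -> N}.

Definition loc_fun (y : localization M f) : localization N f :=
  frac f (phi (repr y).1) (repr y).2.

Lemma loc_funE m k : loc_fun (frac f m k) = frac f (phi m) k.
Proof.
apply/fracP; have /fracP[j e] := esym (fracE (frac f m k)).
by exists j; rewrite -!linearZ e.
Qed.

Lemma loc_fun_zmod : zmod_morphism loc_fun.
Proof.
elim/frac_ind=> m k; elim/frac_ind=> m' k'.
by rewrite -fracN fracDD !loc_funE -fracN fracDD linearD !linearZ linearN.
Qed.

HB.instance Definition _ := GRing.isZmodMorphism.Build _ _ loc_fun loc_fun_zmod.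

Lemma loc_fun_inj y : (forall x, phi x = 0 -> x = 0) -> loc_fun y = 0 -> y = 0.
Proof.
move=> inj; elim/frac_ind: y => m k; rewrite loc_funE => /frac_eq0[j].
by rewrite -linearZ => /inj e; apply/frac_eq0; exists j.
Qed.

End LocalizedMaps.

Lemma loc_map_zmod (R : comNzRingType) (M : lmodType R) (f g h : R) :
  g = f * h -> zmod_morphism (@loc_map R M f g h).
Proof.
move=> ge; elim/frac_ind=> m k; elim/frac_ind=> m' k'.
rewrite -fracN fracDD !loc_mapE // -fracN fracDD ge scalerDr !scalerN !scalerA.
by rewrite !exprMn !exprD; congr (frac _ (_ *: _ - _ *: _) _); ring.
Qed.

(** * Signs *)

Section Signs.
Variable n : nat.
Implicit Types (s t : {set 'I_n}) (i j l : 'I_n).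

(** The common sign rule of the Cech and Koszul differentials, in the form used
    by [cech_diff]. *)
Definition cube_sign j t : int := (-1) ^+ #|[set l in t | (l < j)%N]|.

Lemma cube_signU j l t :
  l \notin t -> cube_sign j (l |: t) = (-1) ^+ (l < j)%N * cube_sign j t.
Proof.
move=> lt; rewrite /cube_sign -exprD; congr (_ ^+ _).
case: (boolP (l < j)%N) => lj /=; last first.
  apply: eq_card => i; rewrite !inE; case: eqP => [->|//].
  by rewrite (negPf lj) !andbF.
rewrite (cardsD1 l) !inE eqxx lj; congr (_ + _)%N.
apply: eq_card => i; rewrite !inE; case: eqP => [->|//].
by rewrite (negPf lt).
Qed.

Lemma cube_signV j t : cube_sign j (j |: t) = cube_sign j t.
Proof.
rewrite /cube_sign; congr (_ ^+ _); apply: eq_card => i; rewrite !inE.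
by case: eqP => [->|//]; rewrite ltnn !andbF.
Qed.

Lemma cube_sign_sqr j t : cube_sign j t * cube_sign j t = 1.
Proof. by rewrite -expr2 sqrr_sign. Qed.

Lemma sign_ltn_swap i j : i != j -> (-1) ^+ (i < j)%N = - (-1) ^+ (j < i)%N :> int.
Proof.
move=> ij; case: ltngtP => //= e; by rewrite ?opprK // (val_inj e) eqxx in ij.
Qed.

(** The cancellation that makes the Cech and Koszul differentials square to 0. *)
Lemma sum_antisym (V : zmodType) (a : 'I_n -> 'I_n -> V) :
  (forall i, a i i = 0) -> (forall i j, i != j -> a i j = - a j i) ->
  \sum_(i < n) \sum_(j < n) a i j = 0.
Proof.
move=> a0 asym.
have -> : \sum_(i < n) \sum_(j < n) a i j =
    \sum_(i < n) \sum_(j < n | (i < j)%N) a i j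
    + \sum_(i < n) \sum_(j < n | (j < i)%N) a i j.
  rewrite -big_split; apply: eq_bigr => i _ /=.
  rewrite (bigID (fun j : 'I_n => (i < j)%N)) /=; congr (_ + _).
  rewrite (bigID (pred1 i)) /= [X in X + _]big1 => [|j /andP[_ /eqP ->]]; last exact: a0.
  rewrite add0r; apply: eq_bigl => j.
  by rewrite -val_eqE /=; case: ltngtP.
rewrite [X in _ + X](exchange_big_dep xpredT) //= -big_split big1 // => i _ /=.
rewrite -big_split big1 // => j ij /=.
by rewrite asym ?addNr // neq_ltn ij.
Qed.

End Signs.

(** * The Cech complex *)

Section Restriction.
Variables (K : fieldType) (n : nat).
Local Notation S := {mpoly K[n]}.
Implicit Types (s t u : {set 'I_n}) (i j l : 'I_n).

Lemma xprodU s t : [disjoint s & t] -> xprod K (s :|: t) = xprod K s * xprod K t.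
Proof.
move=> st; rewrite /xprod -bigU //=.
by apply: eq_bigl => i; rewrite !inE.
Qed.

Lemma xprodD s t : s \subset t -> xprod K t = xprod K s * xprod K (t :\: s).
Proof.
move=> st; rewrite -xprodU; last first.
  by rewrite -setI_eq0; apply/eqP/setP => i; rewrite !inE; case: (i \in s).
congr xprod; apply/setP => i; rewrite !inE.
by case: (boolP (i \in s)) => // /(subsetP st) ->.
Qed.

Lemma xprod1 j : xprod K [set j] = 'X_j.
Proof. by rewrite /xprod big_set1. Qed.

Lemma xprod0 : xprod K (set0 : {set 'I_n}) = 1.
Proof. by rewrite /xprod big_set0. Qed.

Variable M : lmodType S.
Local Notation L s := (localization M (xprod K s)).

(** [loc_map] is additive only when its parameters are compatible.  Returning 0
    otherwise makes restriction a total additive map, and lets restrictions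
    from [s] to [t] compose without transporting along equalities of sets. *)
Definition restr s t (y : L s) : L t :=
  if s \subset t then loc_map (xprod K t) (xprod K (t :\: s)) y else 0.

Lemma restrE s t m k : s \subset t ->
  restr t (frac (xprod K s) m k) = frac (xprod K t) (xprod K (t :\: s) ^+ k *: m) k.
Proof. by move=> st; rewrite /restr st loc_mapE // -xprodD. Qed.

Lemma restr_zmod s t : zmod_morphism (@restr s t).
Proof.
case: (boolP (s \subset t)) => st; last first.
  by move=> x y; rewrite /restr (negPf st) subrr.
rewrite /restr st; apply: loc_map_zmod; exact: xprodD.
Qed.

HB.instance Definition _ s t :=
  GRing.isZmodMorphism.Build _ _ (@restr s t) (@restr_zmod s t).

Lemma restr_comp s t u y :
  s \subset t -> t \subset u -> restr u (@restr s t y) = restr u y.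
Proof.
elim/frac_ind: y => m k st tu; rewrite !restrE ?(subset_trans st tu) //.
rewrite scalerA -exprMn -xprodU; last first.
  by rewrite -setI_eq0; apply/eqP/setP => i; rewrite !inE; case: (i \in t); rewrite ?andbF.
congr (frac _ (xprod K _ ^+ _ *: _) _); apply/setP => i; rewrite !inE.
move/implyP: (subsetP st i); move/implyP: (subsetP tu i).
by case: (i \in s); case: (i \in t); case: (i \in u).
Qed.

Lemma cech_diffE (c : cech_family M) t :
  cech_diff c t = \sum_(j in t) restr t (c (t :\ j)%SET) *~ cube_sign j t.
Proof.
apply: eq_bigr => j jt; congr (_ *~ _).
rewrite /restr subD1set; congr (loc_map _ _ _); rewrite -xprod1.
by congr xprod; apply/setP => i; rewrite !inE; case: eqP => [->|_]; rewrite ?jt ?andNb.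
Qed.

Lemma cech_diffB (c c' : cech_family M) t :
  cech_diff (fun s => c s - c' s) t = cech_diff c t - cech_diff c' t.
Proof.
rewrite !cech_diffE; under eq_bigr => j _ do rewrite raddfB mulrzBl.
exact: sumrB.
Qed.

Lemma cech_diff_sum I (r : seq I) (P : pred I) (c : I -> cech_family M) t :
  cech_diff (fun s => \sum_(i <- r | P i) c i s) t =
  \sum_(i <- r | P i) cech_diff (c i) t.
Proof.
rewrite cech_diffE; under eq_bigr => j _ do rewrite raddf_sum mulrz_suml.
by rewrite exchange_big; apply: eq_bigr => i _; rewrite cech_diffE.
Qed.

Lemma cech_diffMz (c : cech_family M) z t :
  cech_diff (fun s => c s *~ z) t = cech_diff c t *~ z.
Proof.
rewrite !cech_diffE mulrz_suml; apply: eq_bigr => j _.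
by rewrite raddfMz -!mulrzA mulrC.
Qed.

Lemma eq_cech_diff (c c' : cech_family M) t :
  (forall s, c s = c' s) -> cech_diff c t = cech_diff c' t.
Proof. by move=> h; rewrite !cech_diffE; apply: eq_bigr => j _; rewrite h. Qed.

Lemma cech_diff_diff (c : cech_family M) t : cech_diff (cech_diff c) t = 0.
Proof.
pose a j i : L t := if [&& j \in t, i \in t & i != j]
  then restr t (c (t :\ j :\ i)%SET) *~ (cube_sign i (t :\ j)%SET * cube_sign j t)
  else 0.
have -> : cech_diff (cech_diff c) t = \sum_(j < n) \sum_(i < n) a j i.
  rewrite cech_diffE big_mkcond; apply: eq_bigr => j _ /=.
  rewrite /a; case: (boolP (j \in t)) => jt /=; last by rewrite big1.
  rewrite cech_diffE raddf_sum mulrz_suml -big_mkcond /=.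
  apply: eq_big => [i|i ij]; first by rewrite !inE andbC.
  by rewrite raddfMz /= restr_comp ?subD1set // mulrzA.
apply: sum_antisym => [i|i j ij]; first by rewrite /a eqxx !andbF.
rewrite /a [j == i]eq_sym; case: (boolP (i \in t)) => it; last by rewrite andbF oppr0.
case: (boolP (j \in t)) => jt /=; last by rewrite oppr0.
rewrite ij -mulrNz; pose r := (t :\ i :\ j)%SET.
have er : (t :\ j :\ i)%SET = r by apply/setP => l; rewrite !inE andbCA.
have ei : (t :\ i)%SET = j |: r by rewrite setD1K // !inE eq_sym ij jt.
have ej : (t :\ j)%SET = i |: r by rewrite -er setD1K // !inE ij it.
have et : t = i |: (j |: r) by rewrite -ei setD1K.
have hi : i \notin r by rewrite /r !inE eqxx /= andbF.
have hj : j \notin r by rewrite /r !inE eqxx.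
rewrite er; congr (_ *~ _); rewrite ei ej et !cube_signV setUCA cube_signV.
by rewrite !cube_signU // (sign_ltn_swap ij); ring.
Qed.

End Restriction.
(** * Homogeneous cochains *)

Section SquareFree.
Variables (K : fieldType) (n : nat) (G : zmodType) (dg : 'I_n -> G).
Implicit Types s t : {set 'I_n}.

Definition indicator_mnm s : 'X_{1..n} := [multinom (i \in s : nat) | i < n].

Lemma xprodE s : xprod K s = 'X_[indicator_mnm s].
Proof.
rewrite /xprod mprodXE; congr 'X_[_]; apply/mnmP => i; rewrite mnm_sumE mnmE.
rewrite big_mkcond (bigD1 i) //= mnm1E eqxx big1 ?addn0; first by case: (i \in s).
by move=> j /negPf ji; rewrite mnm1E ji; case: ifP.
Qed.

Lemma xprod_exp s k : xprod K s ^+ k = 'X_[(indicator_mnm s *+ k)%MM].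
Proof. by rewrite xprodE mpolyXn. Qed.

Lemma wdegreeMn u k : wdegree dg (u *+ k)%MM = wdegree dg u *+ k.
Proof.
rewrite /wdegree -sumrMnl; apply: eq_bigr => i _.
by rewrite mulmnE mulrnA.
Qed.

Lemma wdegree_indicator s : wdegree dg (indicator_mnm s) = \sum_(j in s) dg j.
Proof.
rewrite /wdegree [RHS]big_mkcond; apply: eq_bigr => i _.
by rewrite mnmE; case: (i \in s).
Qed.

Lemma wdegreeU j : wdegree dg U_(j)%MM = dg j.
Proof.
rewrite /wdegree (bigD1 j) //= mnm1E eqxx big1 ?addr0 // => i /negPf ij.
by rewrite mnm1E eq_sym ij.
Qed.

Lemma xprod_piece s k : poly_piece dg ((\sum_(j in s) dg j) *+ k) (xprod K s ^+ k).
Proof. by rewrite xprod_exp -wdegree_indicator -wdegreeMn; apply: poly_pieceX. Qed.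

End SquareFree.

Section HomogeneousFamilies.
Variables (K : fieldType) (n : nat) (G : zmodType) (dg : 'I_n -> G).
Local Notation S := {mpoly K[n]}.
Variables (M : lmodType S) (Mg : G -> set M).
Implicit Types (s t : {set 'I_n}) (q : G) (P : pred nat).

(** Cochains of degree [q] supported on the index sets whose cardinality
    satisfies [P].  Taking [P m := m.+1 == i] gives the cochains one step below
    [i], which are zero for [i = 0]; this makes the case [i = 0] of local
    cohomology uniform with the others. *)
Definition homog_family P q (c : cech_family M) : Prop :=
  forall s, if P #|s| then loc_piece dg Mg q (c s) else c s = 0.

Lemma local_cohomology_vanishesP i q :
  local_cohomology_vanishes dg Mg i q <->
  forall c, cech_cochain dg Mg i q c -> (forall t, cech_diff c t = 0) ->
  exists2 b, homog_family (fun m => m.+1 == i) q b & forall s, cech_diff b s = c s.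
Proof.
case: i => [|i]; split=> h c hc dc; try exact: h.
  exists (fun=> 0) => [s|s] //=; rewrite (h c hc dc) cech_diffE.
  by rewrite big1 // => j _; rewrite raddf0 mul0rz.
have [b hb db] := h c hc dc.
by move=> s; rewrite -db cech_diffE big1 // => j _; rewrite (hb (s :\ j)) raddf0 mul0rz.
Qed.

Hypothesis hM : is_graded_module dg Mg.

Lemma loc_piece_frac s q m k :
  Mg (q + (\sum_(j in s) dg j) *+ k) m -> loc_piece dg Mg q (frac (xprod K s) m k).
Proof. by move=> h; exists m, k. Qed.

Lemma loc_piece0 s q : loc_piece dg Mg q (0 : localization M (xprod K s)).
Proof. by rewrite -(frac0 _ _ 0); apply/loc_piece_frac/(piece0 hM). Qed.

Lemma loc_pieceB s q (y z : localization M (xprod K s)) :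
  loc_piece dg Mg q y -> loc_piece dg Mg q z -> loc_piece dg Mg q (y - z).
Proof.
move=> [m [k [-> hm]]] [m' [k' [-> hm']]]; rewrite -fracN fracDD scalerN.
apply/loc_piece_frac/(pieceB hM).
  by rewrite mulrnDr addrA addrC; apply: (pieceZ hM) => //; apply: xprod_piece.
by rewrite mulrnDr addrCA; apply: (pieceZ hM) => //; apply: xprod_piece.
Qed.

Lemma loc_pieceN s q (y : localization M (xprod K s)) :
  loc_piece dg Mg q y -> loc_piece dg Mg q (- y).
Proof. by move=> h; rewrite -[- y]add0r; apply: loc_pieceB => //; apply: loc_piece0. Qed.

Lemma loc_pieceD s q (y z : localization M (xprod K s)) :
  loc_piece dg Mg q y -> loc_piece dg Mg q z -> loc_piece dg Mg q (y + z).
Proof.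
by move=> hy hz; rewrite -[z]opprK; apply: loc_pieceB => //; apply: loc_pieceN.
Qed.

Lemma loc_piece_sum s q I (r : seq I) (Q : pred I)
    (y : I -> localization M (xprod K s)) :
  (forall i, Q i -> loc_piece dg Mg q (y i)) ->
  loc_piece dg Mg q (\sum_(i <- r | Q i) y i).
Proof.
by move=> h; apply: big_ind h => [|x z]; [apply: loc_piece0|apply: loc_pieceD].
Qed.

Lemma loc_pieceMz s q (y : localization M (xprod K s)) z :
  loc_piece dg Mg q y -> loc_piece dg Mg q (y *~ z).
Proof.
move=> h; have hn k : loc_piece dg Mg q (y *+ k).
  by elim: k => [|k ih]; rewrite ?mulrS; [apply: loc_piece0|apply: loc_pieceD].
case: z => k; first by rewrite -pmulrn.
by rewrite NegzE mulrNz -pmulrn; apply: loc_pieceN.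
Qed.

Lemma loc_piece_restr s t q (y : localization M (xprod K s)) :
  s \subset t -> loc_piece dg Mg q y -> loc_piece dg Mg q (restr t y).
Proof.
move=> st [m [k [-> hm]]]; rewrite restrE //; apply/loc_piece_frac.
rewrite (big_setID s) /= (setIidPr st) mulrnDl addrA addrC.
by apply: (pieceZ hM) => //; apply: xprod_piece.
Qed.

Lemma homog_familyB P q c c' : homog_family P q c -> homog_family P q c' ->
  homog_family P q (fun s => c s - c' s).
Proof.
move=> hc hc' s; move: (hc s) (hc' s); case: ifP => _; first exact: loc_pieceB.
by move=> -> ->; rewrite subrr.
Qed.

Lemma homog_familyMz P q c z : homog_family P q c ->
  homog_family P q (fun s => c s *~ z).
Proof.
move=> hc s; move: (hc s); case: ifP => _; first exact: loc_pieceMz.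
by move=> ->; rewrite mul0rz.
Qed.

Lemma homog_family_sum P q I (r : seq I) (Q : pred I) (c : I -> cech_family M) :
  (forall i, Q i -> homog_family P q (c i)) ->
  homog_family P q (fun s => \sum_(i <- r | Q i) c i s).
Proof.
move=> h s; case: ifP => Ps.
  by apply: loc_piece_sum => i /h /(_ s); rewrite Ps.
by rewrite big1 // => i /h /(_ s); rewrite Ps.
Qed.

Lemma cech_diff_cochain i q b :
  homog_family (fun m => m.+1 == i) q b -> cech_cochain dg Mg i q (cech_diff b).
Proof.
move=> hb t; rewrite cech_diffE; case: ifP => ti.
  apply: loc_piece_sum => j jt; apply/loc_pieceMz/loc_piece_restr; first exact: subD1set.
  by have := hb (t :\ j); rewrite -(eqP ti) (cardsD1 j t) jt eqxx.
rewrite big1 // => j jt; have := hb (t :\ j).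
by move: ti; rewrite (cardsD1 j t) jt => -> ->; rewrite raddf0 mul0rz.
Qed.

End HomogeneousFamilies.

Section Functoriality.
Variables (K : fieldType) (n : nat) (G : zmodType) (dg : 'I_n -> G).
Local Notation S := {mpoly K[n]}.
Variables (M N : lmodType S) (Mg : G -> set M) (Ng : G -> set N).
Variable phi : {linear M -> N}.
Implicit Types (s t : {set 'I_n}) (q : G) (P : pred nat).

Lemma restr_loc_fun s t (y : localization M (xprod K s)) :
  restr t (loc_fun phi y) = loc_fun phi (restr t y).
Proof.
case: (boolP (s \subset t)) => st; last first.
  by rewrite /restr (negPf st) raddf0.
by elim/frac_ind: y => m k; rewrite loc_funE !restrE // loc_funE linearZ.
Qed.

Lemma cech_diff_loc_fun (c : cech_family M) t :
  cech_diff (fun s => loc_fun phi (c s)) t = loc_fun phi (cech_diff c t).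
Proof.
rewrite !cech_diffE raddf_sum; apply: eq_bigr => j _.
by rewrite restr_loc_fun raddfMz.
Qed.

Lemma homog_family_loc_fun P q q' (c : cech_family M) :
  (forall a x, Mg (q + a) x -> Ng (q' + a) (phi x)) ->
  homog_family dg Mg P q c -> homog_family dg Ng P q' (fun s => loc_fun phi (c s)).
Proof.
move=> hphi hc s; move: (hc s); case: ifP => _; last by move=> ->; rewrite raddf0.
move=> [m [k [-> hm]]]; rewrite loc_funE; exact/loc_piece_frac/hphi.
Qed.

Lemma homog_family_lift P q (c : cech_family N) :
  (forall a y, Ng a y -> exists2 x, Mg a x & phi x = y) ->
  homog_family dg Ng P q c ->
  exists2 c' : cech_family M, homog_family dg Mg P q c' &
    forall s, loc_fun phi (c' s) = c s.
Proof.
move=> surj hc.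
have H s : exists y : localization M (xprod K s),
    (if P #|s| then loc_piece dg Mg q y else y = 0) /\ loc_fun phi y = c s.
  move: (hc s); case: ifP => _; last by move=> ->; exists 0; rewrite raddf0.
  move=> [m [k [-> /surj[x hx <-]]]].
  by exists (frac (xprod K s) x k); rewrite loc_funE; split=> //; apply: loc_piece_frac.
exists (fun s => projT1 (cid (H s))) => s; by case: (projT2 (cid (H s))).
Qed.

End Functoriality.

(** * Short exact sequences *)

Section ShortExact.
Variables (K : fieldType) (n : nat) (G : zmodType) (dg : 'I_n -> G).
Local Notation S := {mpoly K[n]}.
Variables (N F M : lmodType S).
Variables (Ng : G -> set N) (Fg : G -> set F) (Mg : G -> set M).
Hypothesis hF : is_graded_module dg Fg.
Variables (iota : {linear N -> F}) (phi : {linear F -> M}).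
Hypotheses (iota_piece : forall a x, Ng a x -> Fg a (iota x)).
Hypotheses (phi_piece : forall a x, Fg a x -> Mg a (phi x)).
Hypothesis iota_inj : forall x, iota x = 0 -> x = 0.
Hypothesis phi_iota : forall x, phi (iota x) = 0.
Hypothesis kernel_lift :
  forall a x, Fg a x -> phi x = 0 -> exists2 y, Ng a y & iota y = x.
Hypothesis phi_lift : forall a y, Mg a y -> exists2 x, Fg a x & phi x = y.
Implicit Types (P : pred nat) (q : G).

Lemma loc_phi_iota f (y : localization N f) : loc_fun phi (loc_fun iota y) = 0.
Proof. by elim/frac_ind: y => m k; rewrite !loc_funE phi_iota frac0. Qed.

(** Localization is exact in the middle: a numerator that [phi] sends to 0 in
    the localization is sent to 0 in [M] after multiplication by a power of
    [x_s]. *)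
Lemma homog_family_kernel_lift P q (c : cech_family F) :
  homog_family dg Fg P q c -> (forall s, loc_fun phi (c s) = 0) ->
  exists2 c' : cech_family N, homog_family dg Ng P q c' &
    forall s, loc_fun iota (c' s) = c s.
Proof.
move=> hc c0.
have H s : exists y : localization N (xprod K s),
    (if P #|s| then loc_piece dg Ng q y else y = 0) /\ loc_fun iota y = c s.
  move: (hc s) (c0 s); case: ifP => _; last by move=> -> _; exists 0; rewrite raddf0.
  move=> [m [k [-> hm]]]; rewrite loc_funE => /frac_eq0[j].
  have hjm : Fg (q + (\sum_(i in s) dg i) *+ (j + k)) (xprod K s ^+ j *: m).
    by rewrite mulrnDr addrCA; apply: (pieceZ hF) => //; apply: xprod_piece.
  rewrite -linearZ => /(kernel_lift hjm)[y hy ey].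
  exists (frac (xprod K s) y (j + k)); rewrite loc_funE ey frac_scale.
  by split=> //; apply: loc_piece_frac.
exists (fun s => projT1 (cid (H s))) => s; by case: (projT2 (cid (H s))).
Qed.

(** Exactness of [H^(i-1)(M) -> H^i(N) -> H^i(F)] in degree [q].  A cocycle of
    [N] becomes a coboundary [D b] in [F]; the image of [b] in [M] is a cocycle, and
    correcting [b] by a lift of its primitive brings it back into [N]. *)
Lemma vanishes_kernel i q :
  local_cohomology_vanishes dg Fg i q ->
  (forall i', i = i'.+1 -> local_cohomology_vanishes dg Mg i' q) ->
  local_cohomology_vanishes dg Ng i q.
Proof.
move=> /local_cohomology_vanishesP vF vM; apply/local_cohomology_vanishesP => c hc dc.
have hc1 : homog_family dg Ng (fun m => m == i) q c := hc.
have [||b hb db] := vF (fun s => loc_fun iota (c s)).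
- by apply: (homog_family_loc_fun _ hc1) => a' x; apply: iota_piece.
- by move=> t; rewrite cech_diff_loc_fun dc raddf0.
have [a ha da] : exists2 a, homog_family dg Fg (fun m => m.+2 == i) q a &
    forall s, loc_fun phi (cech_diff a s) = loc_fun phi (b s).
  have db0 t : cech_diff (fun s => loc_fun phi (b s)) t = 0.
    by rewrite cech_diff_loc_fun db loc_phi_iota.
  have hpb : homog_family dg Mg (fun m => m.+1 == i) q (fun s => loc_fun phi (b s)).
    by apply: (homog_family_loc_fun _ hb) => a' x; apply: phi_piece.
  case: i {vF c hc hc1 dc db} vM hb hpb => [|i'] vM hb hpb.
    exists (fun=> 0) => [s|s] //; rewrite (hb s) cech_diffE big1 // => j _.
    by rewrite raddf0 mul0rz.
  have [a ha da] := (local_cohomology_vanishesP _ _ _ _).1 (vM i' erefl) _ hpb db0.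
  have [a' ha' ea'] := homog_family_lift phi_lift ha.
  exists a' => [//|s]; rewrite -da -cech_diff_loc_fun.
  exact: eq_cech_diff.
have hba : homog_family dg Fg (fun m => m.+1 == i) q (fun s => b s - cech_diff a s).
  apply: (homog_familyB hF) => //; case: i {vF vM c hc hc1 dc db} hb ha => [|i'] hb ha.
    move=> s; rewrite cech_diffE big1 // => j _.
    by rewrite (ha (s :\ j)) raddf0 mul0rz.
  exact: (cech_diff_cochain hF).
have [|b' hb' eb'] := homog_family_kernel_lift hba.
  by move=> s; rewrite raddfB /= da subrr.
exists b' => [//|s]; apply/eqP; rewrite -subr_eq0; apply/eqP.
apply: (loc_fun_inj iota_inj); rewrite raddfB /= -cech_diff_loc_fun.
by rewrite (eq_cech_diff _ eb') cech_diffB cech_diff_diff subr0 db subrr.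
Qed.

(** Exactness of [H^i(F) -> H^i(M) -> H^(i+1)(N)] in degree [q]; the coboundary
    of a lift [c'] of the cocycle represents the connecting map. *)
Lemma vanishes_quotient i q :
  local_cohomology_vanishes dg Fg i q ->
  local_cohomology_vanishes dg Ng i.+1 q ->
  local_cohomology_vanishes dg Mg i q.
Proof.
move=> /local_cohomology_vanishesP vF /local_cohomology_vanishesP vN.
apply/local_cohomology_vanishesP => c hc dc.
have hc1 : homog_family dg Mg (fun m => m == i) q c := hc.
have [c' hc' ec'] := homog_family_lift phi_lift hc1.
have hdc : homog_family dg Fg (fun m => m == i.+1) q (cech_diff c').
  exact: (cech_diff_cochain hF).
have [|b hb eb] := homog_family_kernel_lift hdc.
  by move=> s; rewrite -cech_diff_loc_fun (eq_cech_diff _ ec') dc.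
have [t|a ha da] := vN b hb.
  apply: (loc_fun_inj iota_inj); rewrite -cech_diff_loc_fun.
  by rewrite (eq_cech_diff _ eb) cech_diff_diff.
have hia : homog_family dg Fg (fun m => m.+1 == i.+1) q (fun s => loc_fun iota (a s)).
  by apply: (homog_family_loc_fun _ ha) => a' x; apply: iota_piece.
have [||e he de] := vF (fun s => c' s - loc_fun iota (a s)).
- exact: (@homog_familyB _ _ _ _ _ _ hF (fun m => m == i)).
- by move=> t; rewrite cech_diffB cech_diff_loc_fun da eb subrr.
exists (fun s => loc_fun phi (e s)) => [|s].
  by apply: (homog_family_loc_fun _ he) => a' x; apply: phi_piece.
by rewrite cech_diff_loc_fun de raddfB /= ec' loc_phi_iota subr0.
Qed.

End ShortExact.
(** * Local cohomology of free modules *)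

(** A cube of copies of [V] with identity maps is contractible in each
    direction [l], so a cocycle is a coboundary. *)
Lemma cube_homotopy (n : nat) (V : zmodType) (F : {set 'I_n} -> V) (l : 'I_n) :
  (forall t : {set 'I_n}, \sum_(j in t) F (t :\ j) *~ cube_sign j t = 0) ->
  forall t : {set 'I_n}, \sum_(j in t) (if l \in t :\ j then 0
      else F (l |: (t :\ j)) *~ cube_sign l (t :\ j)) *~ cube_sign j t = F t.
Proof.
move=> cocycle t; case: (boolP (l \in t)) => lt.
  rewrite (bigD1 l) //= !inE eqxx /= setD1K // big1 => [|j /andP[_ jl]]; last first.
    by rewrite !inE lt eq_sym jl mul0rz.
  have -> : cube_sign l t = cube_sign l (t :\ l) by rewrite -[in LHS](setD1K lt) cube_signV.
  by rewrite addr0 -mulrzA cube_sign_sqr mulr1z.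
have := cocycle (l |: t).
rewrite big_setU1 //= cube_signV setU1K // => /eqP; rewrite addrC addr_eq0 => /eqP e.
transitivity ((\sum_(j in t) F ((l |: t) :\ j) *~ cube_sign j (l |: t)) *~ - cube_sign l t).
  rewrite mulrz_suml; apply: eq_bigr => j jt.
  have lj : l != j by apply: contraNneq lt => ->.
  have -> : (l |: t) :\ j = l |: (t :\ j).
    by apply/setP => i; rewrite !inE; case: eqP => [->|//]; rewrite eq_sym (negPf lj).
  rewrite !inE (negPf lt) andbF -!mulrzA; congr (_ *~ _).
  have -> : cube_sign l t = (-1) ^+ (j < l)%N * cube_sign l (t :\ j).
    by rewrite -cube_signU ?setD1K // !inE eqxx.
  rewrite cube_signU // (sign_ltn_swap lj).
  by case: (j < l)%N; rewrite /= ?expr0 ?expr1; ring.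
by rewrite e mulNrz mulrNz opprK -mulrzA cube_sign_sqr mulr1z.
Qed.

Section PolynomialRing.
Variables (K : fieldType) (n : nat) (dg : 'I_n -> int).
Hypothesis dg_ge0 : forall i, 0 <= dg i.
Local Notation S := {mpoly K[n]}.
Implicit Types (s t : {set 'I_n}).

Lemma common_denominator (i : nat) (q : int) (c : cech_family S^o) :
  cech_cochain dg (poly_piece dg : int -> set S^o) i q c ->
  exists (N : nat) (f : {set 'I_n} -> S),
    (forall s, c s = frac (xprod K s) (f s : S^o) N) /\
    forall s, if #|s| == i then poly_piece dg (q + (\sum_(j in s) dg j) *+ N) (f s)
              else f s = 0.
Proof.
move=> hc.
have H s : exists mk : S * nat, c s = frac (xprod K s) (mk.1 : S^o) mk.2 /\
    if #|s| == i then poly_piece dg (q + (\sum_(j in s) dg j) *+ mk.2) mk.1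
    else mk.1 = 0.
  move: (hc s); case: ifP => _; first by move=> [m [k [-> hm]]]; exists (m, k).
  by move=> ->; exists (0, 0%N); rewrite frac0.
have [mk hmk] := boolp.choice H.
pose N := \max_(s : {set 'I_n}) (mk s).2.
have leN s : ((mk s).2 <= N)%N by exact: (leq_bigmax (F := fun s => (mk s).2)).
exists N, (fun s => xprod K s ^+ (N - (mk s).2) * (mk s).1); split=> s.
  by rewrite (hmk s).1 -(frac_scale _ (N - (mk s).2)) subnK.
have [_] := hmk s; case: ifP => _ h; last first.
  by rewrite h mulr0.
rewrite -[X in _ *+ X](subnK (leN s)) mulrnDr addrCA.
by apply: poly_pieceM => //; apply: xprod_piece.
Qed.

Lemma xprodCD1 t j : j \in t ->
  xprod K (~: (t :\ j)) = xprod K (~: t) * 'X_j.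
Proof.
move=> jt; rewrite -(xprod1 K j) -xprodU.
  congr xprod; apply/setP => i; rewrite !inE negb_and negbK orbC; congr (_ || _).
by rewrite -setI_eq0; apply/eqP/setP => i; rewrite !inE; case: eqP => [->|_]; rewrite ?jt ?andbF.
Qed.

Lemma xprod_neq0 s : xprod K s != 0.
Proof. by rewrite xprodE -msupp_eq0 msuppX. Qed.

Lemma cech_diff_frac (M : lmodType S) (f : {set 'I_n} -> M) N t :
  cech_diff (fun s => frac (xprod K s) (f s) N) t =
  frac (xprod K t) (\sum_(j in t) ('X_j ^+ N *: f (t :\ j)) *~ cube_sign j t) N.
Proof.
rewrite cech_diffE frac_sum; apply: eq_bigr => j jt.
have tj : t :\: (t :\ j) = [set j].
  by apply/setP => i; rewrite !inE; case: eqP => [->|_]; rewrite ?jt ?andNb.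
by rewrite restrE ?subD1set // fracMz tj xprod1.
Qed.

(** Brings the numerators over [x_1 ... x_n] as common denominator; the
    restriction maps of the Cech complex become inclusions. *)
Lemma numerator_diff (f : {set 'I_n} -> S) N t :
  xprod K (~: t) ^+ N *
    (\sum_(j in t) ('X_j ^+ N *: (f (t :\ j) : S^o) : S) *~ cube_sign j t) =
  \sum_(j in t) (xprod K (~: (t :\ j)) ^+ N * f (t :\ j)) *~ cube_sign j t.
Proof.
rewrite mulr_sumr; apply: eq_bigr => j jt.
by rewrite mulrzAr mulrA xprodCD1 // exprMn.
Qed.

(** The Cech complex of [S] splits into its Laurent monomials [x^u]; the part of
    [u] is a cube with one direction for each nonnegative entry of [u], so it is
    contractible unless all entries are negative.  Such a monomial occurs only
    in cohomological degree [n], and its degree is at most [- \sum_j dg j]. *)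
Lemma polynomial_ring_vanishes (i : nat) (q : int) :
  i <> n \/ - \sum_(j < n) dg j < q ->
  local_cohomology_vanishes dg (poly_piece dg : int -> set S^o) i q.
Proof.
move=> hiq; apply/local_cohomology_vanishesP => c hc dc.
have [N [f [ec hf]]] := common_denominator hc.
pose F s : S := xprod K (~: s) ^+ N * f s.
have cocycle t : \sum_(j in t) F (t :\ j) *~ cube_sign j t = 0.
  have := dc t; rewrite (eq_cech_diff _ ec) cech_diff_frac => /frac_eq0[P /eqP].
  rewrite -[X in X == 0]/(xprod K t ^+ P * _) mulf_eq0 expf_eq0.
  rewrite (negPf (xprod_neq0 _)) andbF /= => /eqP e.
  by rewrite -numerator_diff e mulr0.
have F_ge s u l : (F s)@_u != 0 -> l \notin s -> (N <= u l)%N.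
  rewrite /F xprod_exp -mcoeff_msupp => hu ls.
  move: (msuppM_le hu) => /allpairsP[[a b] /= [ha hb ->]].
  move: ha; rewrite msuppX mem_seq1 => /eqP ->.
  by rewrite mnmDE mulmnE mnmE finset.in_setC ls mul1n leq_addr.
have F_deg s u : (F s)@_u != 0 ->
    #|s| = i /\ wdegree dg u = q + (\sum_(j < n) dg j) *+ N.
  move: (hf s); rewrite /F; case: eqP => [<-|_] h; last by rewrite h mulr0 mcoeff0 eqxx.
  move=> hu; split=> //; move: u hu; apply/poly_piece_coef.
  rewrite (bigID (mem s)) /= mulrnDl addrA addrC.
  apply: poly_pieceM => //.
  have := @xprod_piece K n _ dg (~: s) N.
  by rewrite (eq_bigl (fun j => j \notin s)) => [|j]; rewrite ?finset.in_setC.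
(* Exponents in F are those of Laurent monomials shifted by N, so [first u] is
   a direction in which the Laurent exponent is nonnegative. *)
pose first u := [pick l : 'I_n | (N <= u l)%N].
pose part l := @poly_restrict K n (fun u => first u == Some l).
have sum_part s : \sum_l part l (F s) = F s.
  apply/mpolyP => u; rewrite raddf_sum /=.
  under eq_bigr => l _ do rewrite mcoeff_restrict.
  case E: (first u) => [l|].
    rewrite (bigD1 l) //= eqxx big1 ?addr0 // => l' /negPf ll'.
    by case: eqP => // -[e]; rewrite e eqxx in ll'.
  rewrite big1 //; apply/esym/eqP; apply: contraT => hu.
  have lt_uN l : (u l < N)%N.
    by move: E; rewrite /first; case: pickP => // h _; rewrite ltnNge h.
  have es : s = setT.
    by apply/setP => l; rewrite inE; apply: contraT => /(F_ge _ _ _ hu); rewrite leqNgt lt_uN.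
  have [ei eu] := F_deg _ _ hu.
  move: ei; rewrite es cardsT card_ord => ei.
  case: hiq => [/(_ (esym ei)) //|hq].
  have : wdegree dg u <= (\sum_(j < n) dg j) *+ N - \sum_(j < n) dg j.
    rewrite /wdegree -sumrMnl -sumrB; apply: ler_sum => j _.
    have := lt_uN j; case: (N) => // N' /= hN'.
    by rewrite mulrS addrAC subrr add0r ler_wpMn2l.
  by rewrite eu [q + _]addrC lerD2l => /(lt_le_trans hq); rewrite ltxx.
(* The cube homotopy in the direction [first u] of each monomial, divided by
   [xprod (~: s) ^+ N] so that it is a numerator over [x_s]. *)
pose g s : S := \sum_(l | l \notin s)
  (\sum_(u <- msupp (F (l |: s)) | first u == Some l)
     (F (l |: s))@_u *: 'X_[(u - indicator_mnm (~: s) *+ N)]) *~ cube_sign l s.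
have g_divides s l u : l \notin s -> u \in msupp (F (l |: s)) -> first u == Some l ->
    (u - indicator_mnm (~: s) *+ N + indicator_mnm (~: s) *+ N = u)%MM.
  move=> ls; rewrite mcoeff_msupp => hu /eqP hl; apply: submK; apply/mnm_lepP => j.
  rewrite mulmnE mnmE in_setC; case: (boolP (j \in s)) => //= js; rewrite mul1n.
  case: (j =P l) => [->|/eqP jl]; last by apply: F_ge hu _; rewrite !inE negb_or jl.
  by move: hl; rewrite /first; case: pickP => // l' h [<-].
have hg s : xprod K (~: s) ^+ N * g s =
    \sum_l (if l \in s then 0 else part l (F (l |: s)) *~ cube_sign l s).
  rewrite mulr_sumr big_mkcond; apply: eq_bigr => l _ /=.
  case: (boolP (l \in s)) => //= ls; rewrite mulrzAr; congr (_ *~ _).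
  rewrite mulr_sumr /part /poly_restrict big_seq_cond [RHS]big_seq_cond.
  apply: eq_bigr => u /andP[hu hl].
  by rewrite -scalerAr xprod_exp -mpolyXD addmC (g_divides s l).
have g_homog s : if #|s|.+1 == i
    then poly_piece dg (q + (\sum_(j in s) dg j) *+ N) (g s) else g s = 0.
  case: eqP => si; last first.
    rewrite /g big1 // => l ls; rewrite big1_seq ?mul0rz // => u /andP[_].
    by rewrite mcoeff_msupp => /F_deg[]; rewrite cardsU1 ls add1n.
  set e := q + _; rewrite /g.
  apply: (big_ind (poly_piece dg e)) => [|x y|l ls]; first exact: poly_piece0.
    exact: poly_pieceD.
  have pieceMz z (p : S) : poly_piece dg e p -> poly_piece dg e (p *~ z).
    by move=> /poly_piece_coef hp; apply/poly_piece_coef => u;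
      rewrite raddfMz /= => h; apply: hp; apply: contraNneq h => ->; rewrite mul0rz.
  apply: pieceMz; rewrite big_seq_cond.
  apply: (big_ind (poly_piece dg e)) => [|x y|u /andP[hu hl]]; first exact: poly_piece0.
    exact: poly_pieceD.
  apply: poly_pieceZ; move: hu (g_divides _ _ _ ls hu hl).
  rewrite mcoeff_msupp => /F_deg[_ hdeg] /(congr1 (wdegree dg)).
  rewrite wdegreeD wdegreeMn wdegree_indicator hdeg.
  rewrite [in RHS](bigID (mem s)) /= mulrnDl addrA.
  rewrite (eq_bigl (fun j => j \notin s)) => [|j]; last by rewrite in_setC.
  by move/addIr; rewrite -/e => <-; apply: poly_pieceX.
have total t :
    \sum_(j in t) (xprod K (~: (t :\ j)) ^+ N * g (t :\ j)) *~ cube_sign j t = F t.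
  rewrite -sum_part; under eq_bigr => j jt do rewrite hg mulrz_suml.
  rewrite exchange_big /=; apply: eq_bigr => l _ /=.
  apply: (cube_homotopy (F := fun s => part l (F s))) => t'.
  transitivity (part l (\sum_(j in t') F (t' :\ j) *~ cube_sign j t')).
    by rewrite /part raddf_sum; apply: eq_bigr => j _; rewrite raddfMz.
  by rewrite cocycle /part raddf0.
exists (fun s => frac (xprod K s) (g s : S^o) N) => [s|t].
  move: (g_homog s); case: ifP => _ h; last by rewrite h frac0.
  exact: loc_piece_frac.
rewrite cech_diff_frac ec; congr frac.
apply: (mulfI (expf_neq0 N (xprod_neq0 (~: t)))).
by rewrite numerator_diff total.
Qed.

End PolynomialRing.

Section FreeModule.
Variables (K : fieldType) (n : nat).
Local Notation S := {mpoly K[n]}.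

Definition scale_by (M : lmodType S) (x : M) (p : S^o) : M := (p : S) *: x.

Lemma scale_by_linear (M : lmodType S) (x : M) : linear (scale_by x).
Proof. by move=> a p q; rewrite /scale_by scalerDl -scalerA. Qed.

HB.instance Definition _ (M : lmodType S) (x : M) :=
  GRing.isLinear.Build S S^o M _ (scale_by x) (scale_by_linear x).

Variable dg : 'I_n -> int.
Hypothesis dg_ge0 : forall i, 0 <= dg i.
Variables (M : lmodType S) (Mg : int -> set M).
Hypothesis hM : is_graded_module dg Mg.
Variables (k : nat) (e : 'I_k -> M) (d : 'I_k -> int).
Hypothesis spanning : homogeneous_generators Mg e d.
Hypothesis independent :
  forall c : 'I_k -> S, \sum_(j < k) c j *: e j = 0 -> forall j, c j = 0.

(** The coordinates make [M] a direct sum of copies of [S], shifted by [d j]. *)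
Lemma free_module_vanishes (i : nat) (q : int) :
  i <> n \/ (forall j, d j - \sum_(l < n) dg l < q) ->
  local_cohomology_vanishes dg Mg i q.
Proof.
move=> hiq; apply/local_cohomology_vanishesP => c hc dc.
pose phi j := coordinate_map spanning independent j.
have H j : exists b : cech_family S^o,
    homog_family dg (poly_piece dg : int -> set S^o) (fun m => m.+1 == i) (q - d j) b /\
    forall s, cech_diff b s = loc_fun (phi j) (c s).
  have hj : i <> n \/ - \sum_(l < n) dg l < q - d j.
    by case: hiq => [?|/(_ j) h]; [left|right; rewrite ltrBrDl].
  have := @polynomial_ring_vanishes K n dg dg_ge0 i _ hj.
  move=> /local_cohomology_vanishesP /(_ (fun s => loc_fun (phi j) (c s))).
  case=> [|t|b hb db]; last by exists b.
    have hc1 : homog_family dg Mg (fun m => m == i) q c := hc.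
    apply: (homog_family_loc_fun _ hc1) => a x hx.
    by rewrite addrAC; apply: coordinate_piece.
  by rewrite cech_diff_loc_fun dc raddf0.
have [b hb] := boolp.choice H.
exists (fun s => \sum_(j < k) loc_fun (scale_by (e j)) (b j s)) => [|s].
  apply: (homog_family_sum hM) => j _.
  apply: (homog_family_loc_fun _ (hb j).1) => a x hx.
  have -> : q + a = (q - d j + a) + d j by rewrite addrAC subrK.
  by apply: (pieceZ hM) => //; apply: spanning.1.
rewrite cech_diff_sum; under eq_bigr => j _ do rewrite cech_diff_loc_fun (hb j).2.
elim/frac_ind: (c s) => m N; under eq_bigr => j _ do rewrite !loc_funE.
by rewrite -frac_sum {2}[m](coordinate_sum spanning).
Qed.

End FreeModule.
(** * Generation in bounded degree *)

Section Koszul.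
Variables (K : fieldType) (n : nat) (M : lmodType {mpoly K[n]}).
Variable y : 'I_n -> {linear M -> M}.
Hypothesis y_comm : forall i j x, y i (y j x) = y j (y i x).
Implicit Types (J s t : {set 'I_n}) (w : {set 'I_n} -> cech_family M).

(** The Koszul differential of the operators [y], applied to each of the
    localizations in the Cech complex. *)
Definition koszul w J : cech_family M :=
  fun s => \sum_(l | l \notin J) loc_fun (y l) (w (l |: J) s) *~ cube_sign l J.

Lemma koszulB w w' J s :
  koszul (fun J s => w J s - w' J s) J s = koszul w J s - koszul w' J s.
Proof.
rewrite /koszul -sumrB; apply: eq_bigr => l _.
by rewrite raddfB mulrzBl.
Qed.

Lemma eq_koszul w w' J s : (forall l, l \notin J -> w (l |: J) s = w' (l |: J) s) ->
  koszul w J s = koszul w' J s.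
Proof. by move=> h; apply: eq_bigr => l /h ->. Qed.

Lemma cech_diff_koszul w J t :
  cech_diff (koszul w J) t = koszul (fun J => cech_diff (w J)) J t.
Proof.
rewrite cech_diff_sum; apply: eq_bigr => l _.
by rewrite cech_diffMz cech_diff_loc_fun.
Qed.

Lemma koszul_koszul w J s : koszul (koszul w) J s = 0.
Proof.
pose a i l : localization M (xprod K s) := if [&& l \notin J, i \notin J & i != l]
  then loc_fun (y l) (loc_fun (y i) (w (i |: (l |: J)) s))
    *~ (cube_sign i (l |: J) * cube_sign l J) else 0.
have -> : koszul (koszul w) J s = \sum_(l < n) \sum_(i < n) a i l.
  rewrite {1}/koszul big_mkcond; apply: eq_bigr => l _.
  rewrite /a; case: (boolP (l \in J)) => lJ /=; first by rewrite big1.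
  rewrite raddf_sum mulrz_suml -big_mkcond; apply: eq_big => [i|i _].
    by rewrite !inE negb_or andbC.
  by rewrite raddfMz mulrzA.
rewrite exchange_big; apply: sum_antisym => [i|i l il]; first by rewrite /a eqxx !andbF.
rewrite /a [l == i]eq_sym; case: (boolP (l \in J)) => lJ /=; first by rewrite andbF oppr0.
case: (boolP (i \in J)) => iJ /=; first by rewrite oppr0.
rewrite il -mulrNz; congr (_ *~ _).
  rewrite setUCA; elim/frac_ind: (w _ _) => m k.
  by rewrite !loc_funE y_comm.
by rewrite !cube_signU // (sign_ltn_swap il); ring.
Qed.

End Koszul.

Section Generation.
Variables (K : fieldType) (n : nat) (dg : 'I_n -> int).
Local Notation S := {mpoly K[n]}.
Variables (M : lmodType S) (Mg : int -> set M).
Hypothesis hM : is_graded_module dg Mg.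
(* Replacing each variable by its power of the common degree [C] gives operators
   of equal degree, as in a standard grading. *)
Variables (C : nat) (a : 'I_n -> nat).
Hypothesis exponent_le : forall l, (a l <= C)%N.
Hypothesis a_deg : forall l, dg l *+ a l = C%:Z.
Implicit Types (J s t : {set 'I_n}).

Let y (l : 'I_n) : {linear M -> M} := *:%R ('X_l ^+ a l : S).

Lemma power_comm i j x : y i (y j x) = y j (y i x).
Proof. by rewrite /= !scalerA mulrC. Qed.

Lemma poly_pieceXn l k : poly_piece dg (dg l *+ k) ('X_l ^+ k : S).
Proof. by rewrite mpolyXn -(wdegreeU dg) -wdegreeMn; apply: poly_pieceX. Qed.

Lemma power_piece l b x : Mg b x -> Mg (b + C%:Z) (y l x).
Proof.
move=> hx; rewrite addrC -(a_deg l); apply: (pieceZ hM) => //.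
exact: poly_pieceXn.
Qed.

Section Element.
Variables (q : int) (m : M).
Hypothesis hm : Mg q m.

(** The element [m / \prod_(l in J) x_l^(a l)] of the localization at [x_J],
    in Koszul position [J]. *)
Definition diagonal_cochain J : cech_family M := fun s =>
  if s == J then frac (xprod K s) ((\prod_(l in s) 'X_l ^+ (C - a l)) *: m) C else 0.

Lemma diagonal_homog J :
  homog_family dg Mg (fun c => c == #|J|) (q - C%:Z *+ #|J|) (diagonal_cochain J).
Proof.
move=> s; rewrite /diagonal_cochain; case: (s =P J) => [->|_]; last first.
  by case: ifP => // _; apply: (loc_piece0 hM).
rewrite eqxx; apply: loc_piece_frac.
have -> : q - C%:Z *+ #|J| + (\sum_(j in J) dg j) *+ C =
    (\sum_(j in J) dg j *+ (C - a j)) + q.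
  rewrite -addrA addrC; congr (_ + _); rewrite -sumrMnl -sumr_const -sumrN -big_split.
  by apply: eq_bigr => l _ /=; rewrite mulrnBr // a_deg addrC.
apply: (pieceZ hM) => //.
apply: (big_ind2 (fun p b => poly_piece dg b p)) => [|p b p' b'|l _].
- apply/poly_piece_coef => u; rewrite mcoeff1 => h.
  by move: h; case: (u =P 0%MM) => [-> _|_]; rewrite ?wdegree0 // eqxx.
- exact: poly_pieceM.
- exact: poly_pieceXn.
Qed.

(** The Cech and the Koszul differentials of the diagonal cochain agree: both
    have the entry [m / \prod_(j in J) x_j^(a j)], up to sign, at [(l |: J, J)],
    and 0 elsewhere. *)
Lemma diagonal_cocycle J t :
  cech_diff (diagonal_cochain J) t = koszul y diagonal_cochain J t.
Proof.
rewrite cech_diffE big_mkcond /koszul [RHS]big_mkcond; apply: eq_bigr => l _ /=.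
rewrite /diagonal_cochain; case: (t =P l |: J) => [->|tJ].
  rewrite setU11; case: (boolP (l \in J)) => lJ /=.
    have /negPf -> : (l |: J) :\ l != J.
      by apply/eqP => e; rewrite -e !inE eqxx in lJ.
    by rewrite raddf0 mul0rz.
  rewrite setU1K // !eqxx cube_signV; congr (_ *~ _).
  rewrite restrE ?subsetUr // loc_funE.
  have -> : (l |: J) :\: J = [set l].
    by apply/setP => i; rewrite !inE; case: eqP => [->|_]; rewrite ?lJ //= andNb.
  rewrite xprod1 big_setU1 //= !scalerA mulrA -exprD subnKC //.
rewrite raddf0 mul0rz if_same; case: ifP => // lt.
case: eqP => [e|_]; last by rewrite raddf0 mul0rz.
by case: tJ; rewrite -e setD1K.
Qed.

Hypothesis vM : forall i, local_cohomology_vanishes dg Mg i (q - C%:Z *+ i).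

(** A descending induction through the Cech-Koszul double complex; vanishing of
    [H^j] in degree [q - j C] lets the correction [w] pass from Koszul degree
    [j + 1] to [j]. *)
Lemma double_complex_descent (j r : nat) : (j + r = n)%N ->
  exists w : {set 'I_n} -> cech_family M,
    (forall J, #|J| = j.+1 ->
       homog_family dg Mg (fun c => c.+1 == j.+1) (q - C%:Z *+ j.+1) (w J)) /\
    forall J t, #|J| = j ->
      cech_diff (fun s => diagonal_cochain J s - koszul y w J s) t = 0.
Proof.
elim: r j => [|r ih] j.
  rewrite addn0 => ->; exists (fun _ _ => 0); split=> [J|J t cJ].
    by move=> cJ; have := max_card (mem J); rewrite cJ card_ord ltnn.
  have -> : J = setT by apply/eqP; rewrite -subset_leqif_cards ?subsetT // cJ cardsT card_ord.
  rewrite cech_diffB diagonal_cocycle cech_diff_koszul /koszul !big_pred0 ?subrr //;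
    by move=> l; rewrite inE.
rewrite addnS -addSn => /ih[w [hw dw]].
have H J : exists b : cech_family M, #|J| = j.+1 ->
    homog_family dg Mg (fun c => c.+1 == j.+1) (q - C%:Z *+ j.+1) b /\
    forall s, cech_diff b s = diagonal_cochain J s - koszul y w J s.
  case: (#|J| =P j.+1) => [cJ|]; last by exists (fun=> 0).
  have [||b hb db] := (local_cohomology_vanishesP _ _ _ _).1 (@vM j.+1)
      (fun s => diagonal_cochain J s - koszul y w J s).
  - apply: (@homog_familyB _ _ _ _ _ _ hM (fun c => c == j.+1)).
      by rewrite -cJ; apply: diagonal_homog.
    apply: (homog_family_sum hM) => l lJ; apply: (homog_familyMz hM).
    have hwl := hw (l |: J) _; rewrite cardsU1 lJ cJ add1n in hwl.
    apply: (homog_family_loc_fun _ (hwl erefl)) => b x hx.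
    have -> : q - C%:Z *+ j.+1 + b = q - C%:Z *+ j.+2 + b + C%:Z.
      by rewrite (mulrS _ j.+1); ring.
    exact: power_piece.
  - by move=> t; apply: dw.
  by exists b.
have [w' hw'] := boolp.choice H.
exists w'; split=> [J /hw'[]//|J t cJ].
rewrite cech_diffB diagonal_cocycle cech_diff_koszul.
have -> : koszul y (fun J => cech_diff (w' J)) J t =
    koszul y (fun J s => diagonal_cochain J s - koszul y w J s) J t.
  apply: eq_koszul => l lJ; apply: (hw' _ _).2.
  by rewrite cardsU1 lJ cJ.
by rewrite koszulB koszul_koszul ?subr0 ?subrr //; apply: power_comm.
Qed.

(** At Koszul degree 0 the descent ends with an equation in the localization
    of [M] at 1, that is, in [M]. *)
Lemma generated_in_lower_degree :
  exists z : 'I_n -> M, m = \sum_(l < n) ('X_l ^+ a l : S) *: z l.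
Proof.
have [w [hw dw]] := double_complex_descent (add0n n).
have [||b hb db] := (local_cohomology_vanishesP _ _ _ _).1 (@vM 0)
   (fun s => diagonal_cochain set0 s - koszul y w set0 s).
- apply: (@homog_familyB _ _ _ _ _ _ hM (fun c => c == 0%N)).
    by have := diagonal_homog set0; rewrite cards0.
  apply: (homog_family_sum hM) => l _; apply: (homog_familyMz hM).
  have hwl := hw (l |: set0) _; rewrite cardsU1 inE cards0 in hwl.
  apply: (homog_family_loc_fun _ (hwl erefl)) => b x hx.
  have -> : q - C%:Z *+ 0 + b = q - C%:Z *+ 1 + b + C%:Z.
    by rewrite mulr0n mulr1n; ring.
  exact: power_piece.
- by move=> t; apply: dw; rewrite cards0.
have := db set0; rewrite cech_diffE big_set0 => /esym/eqP; rewrite subr_eq0 => /eqP e.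
have H l : exists z : M, w (l |: set0) set0 = frac (xprod K set0) z 0.
  elim/frac_ind: (w _ _) => x k; exists x; apply/fracP; exists 0%N.
  by rewrite xprod0 !expr1n.
have [z ez] := boolp.choice H.
exists (fun l => z l *~ cube_sign l set0).
move: e; rewrite /diagonal_cochain eqxx big_set0 scale1r /koszul.
under eq_bigr => l _ do rewrite ez loc_funE -fracMz.
rewrite -frac_sum => /fracP[N]; rewrite xprod0 !expr1n !scale1r => ->.
by apply: eq_big => [l|l _]; rewrite ?inE // raddfMz.
Qed.

End Element.
End Generation.
(** * Kernels as graded modules *)

Section Kernel.
Variables (R : nzRingType) (F M : lmodType R) (phi : {linear F -> M}).

Definition in_kernel : {pred F} := fun x => phi x == 0.

Lemma in_kernel_submod : submod_closed in_kernel.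
Proof.
split=> [|a x y]; rewrite !unfold_in; first by rewrite linear0.
by move=> /eqP ex /eqP ey; rewrite linearP ex ey scaler0 addr0.
Qed.

HB.instance Definition _ := GRing.isSubmodClosed.Build R F in_kernel in_kernel_submod.

Inductive kernel : predArgType := Kernel x & x \in in_kernel.
Definition kernel_val (u : kernel) : F := let: Kernel x _ := u in x.

HB.instance Definition _ := [isSub of kernel for kernel_val].
HB.instance Definition _ := [Choice of kernel by <:].
HB.instance Definition _ := [SubChoice_isSubZmodule of kernel by <:].
HB.instance Definition _ := [SubZmodule_isSubLmodule of kernel by <:].

Lemma kernel_val_linear : linear kernel_val.
Proof. by []. Qed.

HB.instance Definition _ :=
  GRing.isLinear.Build R kernel F _ kernel_val kernel_val_linear.

Lemma kernel_val_eq0 u : kernel_val u = 0 -> u = 0.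
Proof. by move=> h; apply: val_inj; rewrite /= h. Qed.

Lemma phi_kernel_val u : phi (kernel_val u) = 0.
Proof. by case: u => x /= /eqP. Qed.

Lemma kernel_val_surj x : phi x = 0 -> exists u, kernel_val u = x.
Proof. by move=> /eqP h; exists (Kernel h). Qed.

Variables (E : lmodType R) (psi : {linear E -> F}).
Hypothesis phi_psi : forall x, phi (psi x) = 0.

Definition corestrict (x : E) : kernel := Kernel (introT eqP (phi_psi x)).

Lemma corestrict_linear : linear corestrict.
Proof. by move=> a x y; apply: val_inj; rewrite /= linearP. Qed.

HB.instance Definition _ :=
  GRing.isLinear.Build R E kernel _ corestrict corestrict_linear.

Definition corestrict_map : {linear E -> kernel} := corestrict.

End Kernel.

Section GradedMaps.
Variables (K : fieldType) (n : nat) (G : zmodType) (dg : 'I_n -> G).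
Local Notation S := {mpoly K[n]}.
Variables (F M : lmodType S) (Fg : G -> set F) (Mg : G -> set M).
Hypotheses (hF : is_graded_module dg Fg) (hM : is_graded_module dg Mg).
Variable phi : {linear F -> M}.
Hypothesis phi_piece : forall a x, Fg a x -> Mg a (phi x).

Lemma component_linear a x : component hM a (phi x) = phi (component hF a x).
Proof.
have [hx [s [us s0 ex]]] := componentP hF x.
apply: (@componentE _ _ _ _ _ _ hM _ (fun a => phi (component hF a x))); split.
  by move=> b; apply/phi_piece/hx.
exists s; split=> // [b /s0 ->|]; first by rewrite linear0.
by rewrite {1}ex linear_sum.
Qed.

Lemma graded_lift (surj : forall m, exists x, phi x = m) a m :
  Mg a m -> exists2 x, Fg a x & phi x = m.
Proof.
move=> hm; have [x ex] := surj m; exists (component hF a x).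
  exact: component_homog.
by rewrite -component_linear ex (component_piece _ _ hm) eqxx.
Qed.

Definition kernel_piece (a : G) : set (kernel phi) := fun u => Fg a (kernel_val u).

Lemma kernel_graded : is_graded_module dg kernel_piece.
Proof.
split.
- by move=> a; apply: (piece0 hF).
- by move=> a x y; apply: (pieceB hF).
- by move=> a b p x; apply: (pieceZ hF).
- move=> u; have [hx [s [us s0 ex]]] := componentP hF (kernel_val u).
  have H a : exists w : kernel phi, kernel_val w = component hF a (kernel_val u).
    by apply: kernel_val_surj; rewrite -component_linear phi_kernel_val raddf0.
  have [c hc] := boolp.choice H.
  exists s, c; split=> [a|]; first by rewrite /kernel_piece hc; apply: hx.
  apply: val_inj; rewrite -[RHS]/(kernel_val _) -[LHS]/(kernel_val u) linear_sum.
  by rewrite {1}ex; apply: eq_bigr => a _; apply: esym (hc a).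
- move=> s c us hc /(congr1 (@kernel_val _ _ _ phi)); rewrite linear_sum linear0 => e a hs.
  exact/kernel_val_eq0/(piece_free hF us hc e hs).
Qed.

End GradedMaps.

Section ResolutionOfKernel.
Variables (K : fieldType) (n : nat) (G : zmodType) (dg : 'I_n -> G).
Local Notation S := {mpoly K[n]}.
Variables (M : lmodType S) (Mg : G -> set M).
Variables (F : nat -> lmodType S) (Fg : forall i, G -> set (F i)).
Variables (d : forall i, {linear F i.+1 -> F i}) (eps : {linear F 0%N -> M}) (l : nat).
Hypothesis res : is_minimal_free_resolution dg Mg Fg d eps l.

Lemma eps_d x : eps (d 0%N x) = 0.
Proof. by apply/(res_exact0 res); exists x. Qed.

Definition syzygy_map : {linear F 1%N -> kernel eps} := corestrict_map eps_d.

Lemma syzygy_resolution :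
  @is_minimal_free_resolution K n G dg (kernel eps) (kernel_piece (@Fg 0%N) (phi := eps))
    (fun i => F i.+1) (fun i => @Fg i.+1) (fun i => d i.+1) syzygy_map l.-1.
Proof.
split.
- by move=> i; apply: (res_graded res).
- by move=> i; apply: (res_free res).
- by move=> i li; apply: (res_length res); case: l li.
- by move=> i; apply: (res_homog res).
- by move=> a x; apply: (res_homog res).
- move=> u; have [y ey] := (res_exact0 res _).1 (phi_kernel_val u).
  by exists y; apply: val_inj.
- move=> x; rewrite -(res_exactS res); split=> [e|e]; last exact: val_inj.
  by rewrite -[LHS]/(kernel_val (syzygy_map x)) e.
- by move=> i x; apply: (res_exactS res).
- by move=> i x; apply: (res_minimal res).
Qed.

End ResolutionOfKernel.
(** * Regularity of syzygies *)

Section Regularity.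
Variables (K : fieldType) (n : nat) (dg : 'I_n -> int).
Hypothesis dg_gt0 : forall i, 0 < dg i.
Local Notation S := {mpoly K[n]}.

Lemma vanishes_above (M : lmodType S) (Mg : int -> set M)
    (hM : is_graded_module dg Mg) i q :
  (n < i)%N -> local_cohomology_vanishes dg Mg i q.
Proof.
move=> ni; apply/local_cohomology_vanishesP => c hc _; exists (fun=> 0) => [s|s].
  by case: ifP => // _; apply: (loc_piece0 hM).
rewrite cech_diffE big1 => [|j _]; last by rewrite raddf0 mul0rz.
have := hc s; case: eqP => // si.
by have := max_card (mem s); rewrite card_ord si leqNgt ni.
Qed.

Lemma vanishes_trivial (M : lmodType S) (Mg : int -> set M)
    (hM : is_graded_module dg Mg) i q :
  (forall x : M, x = 0) -> local_cohomology_vanishes dg Mg i q.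
Proof.
move=> M0; apply/local_cohomology_vanishesP => c hc _.
have L0 (s : {set 'I_n}) (y : localization M (xprod K s)) : y = 0.
  by elim/frac_ind: y => m k; rewrite (M0 m) frac0.
exists (fun=> 0) => [s|s]; last by rewrite [RHS]L0 [LHS]L0.
by case: ifP => // _; apply: (loc_piece0 hM).
Qed.

(** Descending along a resolution of finite length: free modules have this
    property, and it passes from [F] and [N] to [M] in [0 -> N -> F -> M -> 0]. *)
Lemma vanishes_eventually (b : nat) : forall (M : lmodType S) (Mg : int -> set M)
    (F : nat -> lmodType S) (Fg : forall i, int -> set (F i))
    (d : forall i, {linear F i.+1 -> F i}) (eps : {linear F 0%N -> M}) (l : nat),
  is_graded_module dg Mg -> is_minimal_free_resolution dg Mg Fg d eps l ->
  (forall i, (b <= i)%N -> forall x : F i, x = 0) ->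
  exists p, forall i q, p <= q -> local_cohomology_vanishes dg Mg i q.
Proof.
elim: b => [|b ih] M Mg F Fg d eps l hM res F0.
  exists 0 => i q _; apply: vanishes_trivial => // m.
  by have [x <-] := res_eps_surj res m; rewrite (F0 0%N isT x) linear0.
have hF := res_graded res 0%N.
have hN := kernel_graded hF hM (res_eps_homog res).
have [|p hp] := ih _ _ _ _ _ _ _ hN (syzygy_resolution res).
  by move=> i bi; apply: F0.
have [k [e [dge [spanning independent]]]] := res_free res 0%N.
exists (Num.max p (\sum_(j < k) `|dge j| + 1)) => i q; rewrite ge_max => /andP[pq eq].
apply: (vanishes_quotient hF (Ng := kernel_piece (Fg 0%N) (phi := eps))
  (iota := kernel_val (phi := eps)) (phi := eps)) => //.
- exact: (res_eps_homog res).
- exact: kernel_val_eq0.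
- exact: phi_kernel_val.
- by move=> a x hx /kernel_val_surj[u eu]; exists u => //; rewrite /kernel_piece eu.
- exact: (graded_lift hF hM (res_eps_homog res) (res_eps_surj res)).
- apply: (free_module_vanishes _ hF spanning independent); last right=> j.
    by move=> j; apply: ltW.
  have hb : dge j <= \sum_(i0 < k) `|dge i0|.
    by apply: le_trans (ler_norm _) _; rewrite (bigD1 j) //= lerDl sumr_ge0.
  apply: lt_le_trans eq; rewrite ltzD1 lerBlDr; apply: (le_trans hb).
  by rewrite lerDl sumr_ge0 // => ? _; apply: ltW.
- exact: hp.
Qed.

Variable C : nat.
Hypothesis C_gt0 : (0 < C)%N.
Variable a : 'I_n -> nat.
Hypothesis a_deg : forall l, dg l *+ a l = C%:Z.

(** A single condition on degrees for [p] and all larger integers to lie in the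
    regularity set; see [regular_fromE]. *)
Definition regular_from (M : lmodType S) (Mg : int -> set M) (p : int) : Prop :=
  forall (i : nat) (q : int),
    p + (1 - i%:Z) * C%:Z <= q -> local_cohomology_vanishes dg Mg i q.

Lemma exponent_gt0 l : (0 < a l)%N.
Proof.
by case: posnP (a_deg l) => // -> /eqP; rewrite mulr0n eq_sym eqz_nat (gtn_eqF C_gt0).
Qed.

Lemma exponent_le l : (a l <= C)%N.
Proof.
by rewrite -lez_nat -(a_deg l) -natz ler_wMn2r // -gtz0_ge1.
Qed.

(** Mumford's lemma: a module is generated in degrees less than [p + C].  The
    powers [x_l ^ (a l)] lie in the maximal ideal because [a l] is positive. *)
Lemma regular_generation (M : lmodType S) (Mg : int -> set M)
    (hM : is_graded_module dg Mg) p q m :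
  regular_from Mg p -> p + C%:Z <= q -> Mg q m -> maximal_ideal_submodule m.
Proof.
move=> reg pq hm.
have [|z ->] := generated_in_lower_degree hM exponent_le a_deg hm.
  move=> i; apply: reg; rewrite lerBrDr; apply: le_trans pq.
  by rewrite -mulr_natr natz le_eqVlt; apply/orP; left; apply/eqP; ring.
exists (fun l => ('X_l : S) ^+ (a l).-1 *: z l).
by apply: eq_bigr => l _; rewrite scalerA -exprS prednK // exponent_gt0.
Qed.

Section Resolution.
Variables (M : lmodType S) (Mg : int -> set M).
Hypothesis hM : is_graded_module dg Mg.
Variables (F : nat -> lmodType S) (Fg : forall i, int -> set (F i)).
Variables (d : forall i, {linear F i.+1 -> F i}) (eps : {linear F 0%N -> M}) (l : nat).
Hypothesis res : is_minimal_free_resolution dg Mg Fg d eps l.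
Variable p : int.
Hypothesis reg : regular_from Mg p.

(** Minimality of the resolution transfers the bound from [M] to [F 0]. *)
Lemma regular_generation0 q x :
  p + C%:Z <= q -> @Fg 0%N q x -> maximal_ideal_submodule x.
Proof.
move=> pq hx.
have [y ey] := regular_generation hM reg pq (res_eps_homog res hx).
have [z ez] := boolp.choice (fun i => res_eps_surj res (y i)).
have /(res_exact0 res)[w ew] : eps (x - \sum_(i < n) ('X_i : S) *: z i) = 0.
  rewrite linearB ey linear_sum -sumrB big1 // => i _.
  by rewrite linearZ /= ez subrr.
have [u eu] := res_minimal res w.
exists (fun i => z i + u i); under eq_bigr => i _ do rewrite scalerDr.
by rewrite big_split /= -eu ew addrC subrK.
Qed.

(** In [H^(i-1)(M) -> H^i(N) -> H^i(F 0)] the left term requires [C <= s], since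
    the cohomological degree drops by one.  The right term is nonzero only for
    [i = n] and in degrees up to [e - \sum_i dg i], where [e < p + C] is a
    degree of a generator; this requires [n * C - \sum_i dg i <= s]. *)
Lemma syzygy_regular (s : int) :
  C%:Z <= s -> n%:Z * C%:Z - \sum_(i < n) dg i <= s ->
  regular_from (kernel_piece (@Fg 0%N) (phi := eps)) (p + s).
Proof.
move=> sC sn i q hq.
have hF := res_graded res 0%N.
have hN := kernel_graded hF hM (res_eps_homog res).
have [k [e [dge [spanning independent]]]] := res_free res 0%N.
apply: (vanishes_kernel hF (Mg := Mg) (Ng := kernel_piece (@Fg 0%N) (phi := eps))
  (iota := kernel_val (phi := eps)) (phi := eps)) => //.
- exact: (res_eps_homog res).
- exact: kernel_val_eq0.
- exact: phi_kernel_val.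
- by move=> b x hx /kernel_val_surj[u eu]; exists u => //; rewrite /kernel_piece eu.
- exact: (graded_lift hF hM (res_eps_homog res) (res_eps_surj res)).
- apply: (free_module_vanishes _ hF spanning independent); first by move=> j; apply: ltW.
  case: (i =P n) => [ein|]; [right=> j|by left].
  have hj : dge j < p + C%:Z.
    rewrite ltNge; apply/negP => /(regular_generation0)/(_ (spanning.1 j)).
    exact: (basis_notin_maximal_ideal spanning independent).
  apply: lt_le_trans hq; rewrite ein.
  by move: sn hj; move: (\sum_(_ < _) _) => D sn hj; nia.
- move=> i' ei; apply: reg; apply: le_trans hq; rewrite ei.
  by rewrite -addn1 PoszD; nia.
Qed.

End Resolution.

(** Each syzygy module loses [s] in regularity, and the generators of [F i] are
    those of the [i]-th syzygy module. *)
Lemma resolution_generation (s : int) :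
  C%:Z <= s -> n%:Z * C%:Z - \sum_(i < n) dg i <= s ->
  forall (i : nat) (M : lmodType S) (Mg : int -> set M)
    (F : nat -> lmodType S) (Fg : forall i, int -> set (F i))
    (d : forall i, {linear F i.+1 -> F i}) (eps : {linear F 0%N -> M}) (l : nat) (p : int),
  is_graded_module dg Mg -> is_minimal_free_resolution dg Mg Fg d eps l ->
  regular_from Mg p ->
  forall q (x : F i), p + i%:Z * s + C%:Z <= q -> Fg i q x -> maximal_ideal_submodule x.
Proof.
move=> sC sn; elim=> [|i ih] M Mg F Fg d eps l p hM res reg q x.
  by rewrite mul0r addr0; apply: (regular_generation0 hM res reg).
move=> hq; have hN := kernel_graded (res_graded res 0%N) hM (res_eps_homog res).
apply: (ih _ _ _ _ _ _ _ (p + s) hN (syzygy_resolution res)).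
  exact: (syzygy_regular hM res reg).
by apply: le_trans hq; rewrite -addn1 PoszD mulrDl mul1r -!addrA lerD2l; lia.
Qed.

Lemma regular_eventually (M : lmodType S) (Mg : int -> set M)
    (F : nat -> lmodType S) (Fg : forall i, int -> set (F i))
    (d : forall i, {linear F i.+1 -> F i}) (eps : {linear F 0%N -> M}) (l : nat) :
  is_graded_module dg Mg -> is_minimal_free_resolution dg Mg Fg d eps l ->
  exists p, regular_from Mg p.
Proof.
move=> hM res.
have [|p hp] := vanishes_eventually (b := l.+1) hM res.
  by move=> i; apply: (res_length res).
exists (p + n%:Z * C%:Z) => i q hq; case: (ltnP n i) => ni.
  exact: vanishes_above.
by apply/hp/(le_trans _ hq); nia.
Qed.

End Regularity.
(** * Coarsening the grading *)

Section Coarsening.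
Variables (K : fieldType) (n r : nat) (dg : 'I_n -> 'rV[int]_r) (v : 'rV[int]_r).
Local Notation S := {mpoly K[n]}.

Lemma dotv_zmod : zmod_morphism (fun a : 'rV[int]_r => dotv a v).
Proof.
move=> a b; rewrite /dotv -sumrB; apply: eq_bigr => t _.
by rewrite !mxE mulrBl.
Qed.

Definition dot_with (a : 'rV[int]_r) : int := dotv a v.

HB.instance Definition _ :=
  GRing.isZmodMorphism.Build _ _ dot_with dotv_zmod.

Lemma wdegree_degv (u : 'X_{1..n}) : wdegree (degv dg v) u = dot_with (wdegree dg u).
Proof. by rewrite /wdegree raddf_sum; apply: eq_bigr => i _; rewrite raddfMn. Qed.

Section Module.
Variables (M : lmodType S) (Mg : 'rV[int]_r -> set M).
Hypothesis hM : is_graded_module dg Mg.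

(** The closure properties of the coarsened pieces become linear in terms of the
    components for the fine grading. *)
Lemma coarsenP m x :
  coarsen v Mg m x <-> forall a, dot_with a != m -> component hM a x = 0.
Proof.
split=> [[s [c [hs hc ->]]] a ha|h].
  rewrite raddf_sum big_seq big1 // => b bs /=.
  rewrite (component_piece _ _ (hc b)); case: eqP => // ab.
  by rewrite /dot_with ab hs ?eqxx in ha.
have [hx [s [us s0 ex]]] := componentP hM x.
exists [seq a <- s | dot_with a == m], (component hM ^~ x); split=> //.
  by move=> a; rewrite mem_filter => /andP[/eqP].
rewrite {1}ex (bigID (fun a => dot_with a == m)) /= [X in _ + X]big1 ?addr0 //.
by rewrite big_filter.
Qed.

Lemma coarsen_piece a x : Mg a x -> coarsen v Mg (dotv a v) x.
Proof.
move=> hx; apply/coarsenP => b; rewrite (component_piece _ _ hx).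
by case: (b =P a) => [->|//]; rewrite -[dotv a v]/(dot_with a) eqxx.
Qed.

Lemma coarsen_graded : is_graded_module (degv dg v) (coarsen v Mg).
Proof.
split.
- by move=> m; apply/coarsenP => a _; rewrite raddf0.
- by move=> m x y /coarsenP hx /coarsenP hy; apply/coarsenP => a ha;
    rewrite raddfB /= hx ?hy ?subrr.
- move=> m1 m2 p x hp /coarsenP hx; apply/coarsenP => a ha.
  have [hc [s [_ _ ->]]] := componentP hM x.
  rewrite scaler_sumr raddf_sum big1 // => b _ /=.
  rewrite (component_scale _ _ _ (hc b)).
  have [hb|/hx ->] := eqVneq (dot_with b) m2; last by rewrite scaler0.
  suff -> : poly_component dg (a - b) p = 0 by rewrite scale0r.
  apply/mpolyP => u; rewrite mcoeff_restrict mcoeff0; case: eqP => // eu.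
  apply/eqP; apply: contraNT ha; rewrite -mcoeff_msupp => /hp.
  rewrite -/(wdegree (degv dg v) u) wdegree_degv eu raddfB /= hb => <-.
  by rewrite subrK.
- move=> x; have [hx [s [us s0 ex]]] := componentP hM x.
  exists (undup (map dot_with s)).
  exists (fun m => \sum_(a <- s | dot_with a == m) component hM a x); split.
    move=> m; apply/coarsenP => a ha; rewrite raddf_sum big1 // => b /eqP hb /=.
    rewrite (component_piece _ _ (hx b)); case: eqP => // ab.
    by rewrite ab hb eqxx in ha.
  rewrite (exchange_big_dep xpredT) //= {1}ex !big_seq; apply: eq_bigr => a ha.
  rewrite (eq_bigl (pred1 (dot_with a))) => [|m]; last by rewrite /= eq_sym.
  by rewrite -big_filter filter_pred1_uniq ?undup_uniq ?mem_undup ?map_f // big_seq1.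
- move=> s c us hc e m ms; apply: (@component_eq0 _ _ _ _ _ _ hM) => a.
  have [ha|] := eqVneq (dot_with a) m; last exact: (coarsenP _ _).1 (hc m) a.
  have := raddf0 (component hM a); rewrite -e raddf_sum (bigD1_seq m) //= big1 ?addr0 //.
  move=> m' mm'; apply: ((coarsenP _ _).1 (hc m')); by rewrite ha eq_sym.
Qed.

End Module.

Lemma coarsen_linear (M N : lmodType S) (Mg : 'rV[int]_r -> set M)
    (Ng : 'rV[int]_r -> set N) (phi : {linear M -> N}) :
  (forall a x, Mg a x -> Ng a (phi x)) ->
  forall m x, coarsen v Mg m x -> coarsen v Ng m (phi x).
Proof.
move=> hphi m x [s [c [hs hc ->]]]; exists s, (phi \o c).
by rewrite linear_sum; split=> // a; apply: hphi.
Qed.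

Lemma coarsen_resolution (M : lmodType S) (Mg : 'rV[int]_r -> set M)
    (F : nat -> lmodType S) (Fg : forall i, 'rV[int]_r -> set (F i))
    (d : forall i, {linear F i.+1 -> F i}) (eps : {linear F 0%N -> M}) (l : nat) :
  is_minimal_free_resolution dg Mg Fg d eps l ->
  is_minimal_free_resolution (degv dg v) (coarsen v Mg)
    (fun i => coarsen v (Fg i)) d eps l.
Proof.
move=> res; split.
- by move=> i; apply/coarsen_graded/(res_graded res).
- move=> i; have [k [e [dge [[he hspan] indep]]]] := res_free res i.
  exists k, e, (fun j => dotv (dge j) v); split=> //; split=> // j.
  exact/(coarsen_piece (res_graded res i))/he.
- exact: (res_length res).
- by move=> i; apply/coarsen_linear/(res_homog res).
- exact/coarsen_linear/(res_eps_homog res).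
- exact: (res_eps_surj res).
- exact: (res_exact0 res).
- exact: (res_exactS res).
- exact: (res_minimal res).
Qed.

Hypothesis hv : positive_coarsening dg v.

Lemma wdegree_eq0 (u : 'X_{1..n}) : wdegree dg u = 0 -> u = 0%MM.
Proof.
move=> /(congr1 dot_with); rewrite -wdegree_degv raddf0 => /eqP.
rewrite psumr_eq0 => [/allP h|i _]; last by rewrite mulrn_wge0 // ltW.
apply/mnmP => i; rewrite mnm0E; have := h i (mem_index_enum _).
by rewrite mulrn_eq0 (gt_eqF (hv i)) orbF => /eqP.
Qed.

Local Notation C := (\big[lcmn/1%N]_(i < n) `|degv dg v i|%N).

Lemma lcm_degrees_gt0 : (0 < C)%N.
Proof.
elim/big_ind: _ => // [x y x0 y0|i _]; first by rewrite lcmn_gt0 x0.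
by rewrite absz_gt0 gt_eqF.
Qed.

Lemma degv_lcm i : degv dg v i *+ (C %/ `|degv dg v i|)%N = C%:Z.
Proof.
have di : (`|degv dg v i| %| C)%N by apply: (biglcmn_sup i).
rewrite -mulr_natr natz -{1}(gtz0_abs (hv i)) -PoszM mulnC divnK //.
Qed.

End Coarsening.
(** * The regularity number and the bound *)

(** An inhabited set of integers has an infimum in the extended integers: its
    minimum if it is bounded below, and [-oo] otherwise. *)
Section InfimumOfIntegers.
Variable P : set int.
Hypothesis P_inhabited : exists p, P p.
Local Notation A := [set p%:E%E | p in P]%classic.

Lemma int_minimum (t : int) :
  (forall p, P p -> t <= p) -> exists2 p, P p & forall q, P q -> p <= q.
Proof.
move=> ht; have ex : exists m : nat, `[< P (t + m%:Z) >].
  have [p hp] := P_inhabited; exists `|p - t|%N; apply/asboolP.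
  have -> : t + `|p - t|%N%:Z = p by have := ht p hp; lia.
  exact: hp.
case: (ex_minnP ex) => m /asboolP hm hmin; exists (t + m%:Z) => // q hq.
have e : t + `|q - t|%N%:Z = q by have := ht q hq; lia.
have /hmin : `[< P (t + `|q - t|%N%:Z) >] by apply/asboolP; rewrite e.
by rewrite -[X in _ <= X]e lerD2l lez_nat.
Qed.

Lemma infimum_int_exists : (infimums A !=set0)%classic.
Proof.
have [[t ht]|unbounded] := pselect (exists t : int, forall p, P p -> t <= p).
  have [p hp pmin] := int_minimum ht; exists p%:E%E; split.
    by move=> _ [q hq <-]; rewrite lee_fin pmin.
  by move=> x hx; apply: hx; exists p.
exists -oo%E; split=> [x _|[t| |] hx]; rewrite ?leNye //.
  by case: unbounded; exists t => p hp; rewrite -lee_fin; apply: hx; exists p.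
by have [p hp] := P_inhabited; have := hx p%:E%E; apply; exists p.
Qed.

Lemma infimum_int_le p : P p -> (infimum +oo%E A <= p%:E)%E.
Proof. by move=> hp; apply: le_infimum_Nmem; [apply: infimum_int_exists|exists p]. Qed.

Lemma infimum_int_ge (t : int) :
  (forall p, P p -> t <= p) -> (t%:E <= infimum +oo%E A)%E.
Proof.
move=> ht; rewrite /infimum; case: eqP => [_|_]; first by rewrite leey.
have [_] := xgetPex +oo%E infimum_int_exists; apply.
by move=> _ [p hp <-]; rewrite lee_fin ht.
Qed.

End InfimumOfIntegers.

Section Bound.
Variables (K : fieldType) (n r : nat) (dg : 'I_n -> 'rV[int]_r) (v : 'rV[int]_r).
Local Notation S := {mpoly K[n]}.
Hypothesis hv : positive_coarsening dg v.

Local Notation C := (\big[lcmn/1%N]_(i < n) `|degv dg v i|%N).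

Lemma regular_fromE (M : lmodType S) (Mg : 'rV[int]_r -> set M) p :
  (regv dg v Mg p /\ forall q, p <= q -> regv dg v Mg q) <->
  regular_from (degv dg v) C (coarsen v Mg) p.
Proof.
split=> [[_ h] i q hq|h].
  have := h (q - (1 - i%:Z) * C%:Z) _ i 0%N; rewrite mul0r addr0 subrK.
  by apply; rewrite lerBrDr.
have h' q : p <= q -> regv dg v Mg q.
  move=> pq i k; apply: h; rewrite -addrA lerD // lerDl.
  exact: mulr_ge0.
by split; [apply: h'|].
Qed.

(** Only finitely many exponent vectors [u] have [degv u] below a bound, since
    each variable has positive degree. *)
Lemma translates_finite (k : nat) (b : 'I_k -> 'rV[int]_r) (N : int) :
  finite_set [set a | translates dg b a /\ dotv a v <= N]%classic.
Proof.
pose B := (\sum_(j < k) `|N - dotv (b j) v|)%N.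
pose f (x : 'I_k * {ffun 'I_n -> 'I_B.+1}) := b x.1 + \sum_(i < n) dg i *+ x.2 i.
apply: (@sub_finite_set _ _ [set f x | x in [set: 'I_k * {ffun 'I_n -> 'I_B.+1}]])%classic;
  last exact/finite_image/finite_finset.
move=> a [[j [u [c ->] ->]] hN].
have hc i : (c i < B.+1)%N.
  rewrite ltnS.
  have hi : (c i)%:Z <= N - dotv (b j) v.
    rewrite lerBrDl; apply: le_trans hN.
    rewrite -![dotv _ v]/(dot_with v _) raddfD lerD2l /= raddf_sum /= (bigD1 i) //=.
    rewrite raddfMn /=; apply: (le_trans (y := dot_with v (dg i) *+ c i)).
      by rewrite -natz ler_wMn2r // -gtz0_ge1; apply: hv.
    rewrite lerDl sumr_ge0 // => l _; rewrite raddfMn /= mulrn_wge0 //.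
    exact/ltW/hv.
  apply: (leq_trans (n := `|N - dotv (b j) v|%N)).
    by rewrite -lez_nat gez0_abs //; apply: le_trans hi.
  by rewrite /B (bigD1 j) //= leq_addr.
exists (j, [ffun i => Ordinal (hc i)]) => //.
by rewrite /f /=; congr (_ + _); apply: eq_bigr => i _; rewrite ffunE.
Qed.

Section Resolution.
Variables (M : lmodType S) (Mg : 'rV[int]_r -> set M).
Variables (F : nat -> lmodType S) (Fg : forall i, 'rV[int]_r -> set (F i)).
Variables (d : forall i, {linear F i.+1 -> F i}) (eps : {linear F 0%N -> M}) (l : nat).
Hypothesis res : is_minimal_free_resolution dg Mg Fg d eps l.
Variables (k : nat) (b : 'I_k -> 'rV[int]_r).
Hypothesis supp : forall a, (exists2 x : M, Mg a x & x <> 0) -> translates dg b a.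

Lemma translatesD c u : translates dg b c -> translates dg b (c + wdegree dg u).
Proof.
move=> [j [w [c1 ->] ->]]; exists j; exists (\sum_(i < n) dg i *+ (c1 i + u i)%N).
  by exists (fun i => c1 i + u i)%N.
rewrite -addrA /wdegree -big_split; congr (_ + _); apply: eq_bigr => i _ /=.
by rewrite mulrnDr.
Qed.

(** By minimality the differential kills no basis element, so the degrees of a
    basis of [F i.+1] are degrees of nonzero elements of [F i]. *)
Lemma resolution_support i a x : @Fg i a x -> x <> 0 -> translates dg b a.
Proof.
elim: i a x => [|i ih] a x hx x0.
  have [m [e [dge [spanning independent]]]] := res_free res 0%N.
  have [j [u ->]] := free_module_support spanning independent (res_graded res 0%N) hx x0.
  apply/translatesD/supp; exists (eps (e j)); first exact/(res_eps_homog res)/spanning.1.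
  move=> /(res_exact0 res)[w ew].
  by apply: (basis_notin_maximal_ideal spanning independent (j := j)); rewrite -ew;
    apply: (res_minimal res).
have [m [e [dge [spanning independent]]]] := res_free res i.+1.
have [j [u ->]] := free_module_support spanning independent (res_graded res i.+1) hx x0.
apply: translatesD; apply: (ih _ (d i (e j))); first exact/(res_homog res)/spanning.1.
move=> /(res_exactS res)[w ew].
by apply: (basis_notin_maximal_ideal spanning independent (j := j)); rewrite -ew;
  apply: (res_minimal res).
Qed.

End Resolution.
End Bound.

(** The bound holds for every [p] in the set whose infimum is the regularity
    number, hence for the infimum; this includes the value [-oo], for which no
    generator can exist.  That this set is inhabited is what makes the degree
    set finite. *)
Theorem corollary3p11 (K : fieldType) (n r : nat) (dg : 'I_n -> 'rV[int]_r)
  (hpos : positively_multigraded dg)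
  (M : lmodType {mpoly K[n]}) (Mg : 'rV[int]_r -> set M)
  (hM : is_graded_module dg Mg) (hfg : finitely_generated M)
  (v : 'rV[int]_r) (hv : positive_coarsening dg v)
  (F : nat -> lmodType {mpoly K[n]})
  (Fg : forall i : nat, 'rV[int]_r -> set (F i))
  (d : forall i : nat, {linear F i.+1 -> F i}) (eps : {linear F 0%N -> M})
  (l : nat) (hF : is_minimal_free_resolution dg Mg Fg d eps l)
  (k : nat) (b : 'I_k -> 'rV[int]_r)
  (hsupp : forall a : 'rV[int]_r,
     (exists2 x : M, Mg a x & x <> 0%R) -> translates dg b a) :
  forall i : nat,
    finite_set (degree_bound_set dg v Mg b i) /\
    forall (m : nat) (g : 'I_m -> F i) (dgen : 'I_m -> 'rV[int]_r),
      minimal_generators (Fg i) g dgen ->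
      forall j : 'I_m, degree_bound_set dg v Mg b i (dgen j).
Proof.
move=> i; set P := [set p | regv dg v Mg p /\ forall q, p <= q -> regv dg v Mg q]%classic.
have hMv := coarsen_graded v hM; have hFv := coarsen_resolution v hF.
have C0 := lcm_degrees_gt0 hv; have Ca := degv_lcm hv.
have P_inhabited : exists p, P p.
  have [p hp] := regular_eventually hv C0 hMv hFv.
  by exists p; apply/regular_fromE.
split.
  have [p hp] := P_inhabited.
  apply: sub_finite_set (translates_finite hv b (p + (i%:Z * sv dg v + cv dg v - 1))).
  move=> a [ha hle]; split=> //; rewrite -lee_fin EFinD; apply: (le_trans hle).
  by rewrite leeD2r // infimum_int_le.
move=> m g dgen hg j.
have g_max := minimal_generator_notin_maximal_ideal (wdegree_eq0 hv) (res_graded hF i) hg.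
split.
  apply: (resolution_support hF hsupp (hg.1.1 j)) => gj0; apply: (g_max j).
  by exists (fun=> 0); rewrite gj0 big1 // => ? _; rewrite scaler0.
rewrite -leeBlDr // -EFinB; apply: infimum_int_ge => // p /regular_fromE reg.
rewrite lerBlDr leNgt; apply/negP => hlt; apply: (g_max j).
have hCs : cv dg v <= sv dg v by rewrite /sv le_max lexx orbT.
have hns : n%:Z * cv dg v - \sum_(i < n) degv dg v i <= sv dg v by rewrite /sv le_max lexx.
apply: (resolution_generation hv C0 Ca hCs hns hMv hFv reg (q := dotv (dgen j) v)).
  by move: hlt; rewrite -[cv dg v]/(Posz _) => hlt; lia.
exact: (coarsen_piece v (res_graded hF i) (hg.1.1 j)).
Qed.
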